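(* There exist universal constants $\mathcal{C}>0$ and $c_0>0$ such that the following holds. Let $A$ be a real $m\times n$ matrix, $b\in\mathbb{R}^m$, $c\in\mathbb{R}^n$, where $b$, $c$ and all columns of $A$ have unit Euclidean norm. Consider the linear program $P\equiv\min\{c^\top x \mid Ax=b,\ x\in\mathbb{R}^n_+\}$, with feasible region $\mathcal{F}(P)$ and optimal value $v(P)$, and assume that $\mathcal{F}(P)$ is bounded and non-empty. Let $\theta\ge 1$ be such that there exists an optimal solution $x^*$ of $P$ with $\sum_{j=1}^n x^*_j<\theta$. Let $y^*$ be an optimal solution of the dual of $P$, i.e. of $\max\{b^\top y\mid A^\top y\le c,\ y\in\mathbb{R}^m\}$, of minimal Euclidean norm. Let $0<\delta\le |v(P)|$, let $T$ be a $k\times m$ random projector, and let $v(P_{T,\theta})$ be the optimal value of $$P_{T,\theta}\equiv\min\Big\{c^\top x \;\Big|\; TAx=Tb,\ \sum_{j=1}^n x_j\le\theta,\ x\in\mathbb{R}^n_+\Big\}.$$ Then $$v(P)-\delta\le v(P_{T,\theta})\le v(P)$$ with probability at least $1-4n\,e^{-\mathcal{C}(\varepsilon^2-\varepsilon^3)k}$, where $\varepsilon=c_0\,\dfrac{\delta}{\theta^2\|y^*\|}$.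
   Context: All norms are Euclidean. A $k\times m$ random projector is a random $k\times m$ real matrix $T$ of one of the following four types: (1) $T=\sqrt{m/k}$ times the orthogonal projection of $\mathbb{R}^m$ onto a uniformly random $k$-dimensional linear subspace ($k\le m$), written as a $k\times m$ matrix using an orthonormal basis of the subspace; (2) $T=\frac{1}{\sqrt{k}}U$ with $U$ having independent standard normal entries; (3) $T=\frac{1}{\sqrt{k}}U$ with $U$ having independent entries equal to $+1$ or $-1$ with probability $\frac12$ each; (4) $T=\sqrt{3/k}\,U$ with $U$ having independent entries equal to $+1,0,-1$ with probabilities $\frac16,\frac23,\frac16$. In all cases $\mathbb{E}\|Ty\|^2=\|y\|^2$ for every $y\in\mathbb{R}^m$. *)

(* Defs.v *)
From HB Require Import structures.
From mathcomp Require Import all_boot all_order all_algebra.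
From mathcomp Require Import all_classical all_reals all_analysis.

Set Implicit Arguments.
Unset Strict Implicit.
Unset Printing Implicit Defensive.

Import Order.TTheory GRing.Theory Num.Theory.
Import numFieldNormedType.Exports.

Local Open Scope classical_set_scope.
Local Open Scope ring_scope.

Definition dotv (R : realType) (n : nat) (u v : 'cV[R]_n) : R :=
  (u^T *m v) 0 0.

(* The library norm on matrices is the sup norm, hence this definition. *)
Definition enorm (R : realType) (n : nat) (v : 'cV[R]_n) : R :=
  Num.sqrt (dotv v v).

Definition feasible (R : realType) (m n : nat) (A : 'M[R]_(m, n))
    (b : 'cV[R]_m) : set 'cV[R]_n :=
  [set x | A *m x = b /\ forall j, 0 <= x j 0].

Definition dual_feasible (R : realType) (m n : nat) (A : 'M[R]_(m, n))
    (c : 'cV[R]_n) : set 'cV[R]_m :=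
  [set y | forall j, (A^T *m y) j 0 <= c j 0].

Definition projected_feasible (R : realType) (m n k : nat) (A : 'M[R]_(m, n))
    (b : 'cV[R]_m) (T : 'M[R]_(k, m)) (theta : R) : set 'cV[R]_n :=
  feasible (T *m A) (T *m b) `&` [set x | \sum_j x j 0 <= theta].

(* Value of min {c^T x | x in F}; it is +oo when F is empty. *)
Definition min_value (R : realType) (n : nat) (c : 'cV[R]_n)
    (F : set 'cV[R]_n) : \bar R :=
  ereal_inf [set (dotv c x)%:E | x in F].

Definition minimizer (R : realType) (n : nat) (c : 'cV[R]_n)
    (F : set 'cV[R]_n) (x : 'cV[R]_n) : Prop :=
  F x /\ forall x', F x' -> dotv c x <= dotv c x'.

Definition maximizer (R : realType) (m : nat) (b : 'cV[R]_m)
    (F : set 'cV[R]_m) (y : 'cV[R]_m) : Prop :=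
  F y /\ forall y', F y' -> dotv b y' <= dotv b y.

Definition min_norm_dual_optimum (R : realType) (m n : nat) (A : 'M[R]_(m, n))
    (b : 'cV[R]_m) (c : 'cV[R]_n) (y : 'cV[R]_m) : Prop :=
  maximizer b (dual_feasible A c) y /\
  forall y', maximizer b (dual_feasible A c) y' -> enorm y <= enorm y'.

Section RandomProjector.
Context {d : measure_display} {W : measurableType d} {R : realType}.
Variable P : probability W R.

Definition mutually_independent (I : finType) (X : I -> {RV P >-> R}) : Prop :=
  forall (J : {set I}) (B : I -> set R), (forall i, measurable (B i)) ->
    P (\bigcap_(i in [set` J]) (X i @^-1` B i)) =
    (\prod_(i in J) P (X i @^-1` B i))%E.

Definition random_mx (k m : nat) (U : 'I_k -> 'I_m -> {RV P >-> R}) (w : W) :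
    'M[R]_(k, m) :=
  \matrix_(i, j) U i j w.

Definition independent_entries (k m : nat)
    (U : 'I_k -> 'I_m -> {RV P >-> R}) : Prop :=
  mutually_independent (fun ij : 'I_k * 'I_m => U ij.1 ij.2).

Definition standard_normal (X : {RV P >-> R}) : Prop :=
  forall B : set R, measurable B -> distribution P X B = normal_prob 0 1 B.

Definition rademacher (X : {RV P >-> R}) : Prop :=
  P (X @^-1` [set 1]) = (1 / 2)%:E /\ P (X @^-1` [set -1]) = (1 / 2)%:E.

Definition sparse_sign (X : {RV P >-> R}) : Prop :=
  [/\ P (X @^-1` [set 1]) = (1 / 6)%:E,
      P (X @^-1` [set 0]) = (2 / 3)%:E &
      P (X @^-1` [set -1]) = (1 / 6)%:E].

(* The rows of Q are an orthonormal basis of a random subspace, which is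
   identified with its orthogonal projection matrix Q^T Q. The orthogonal map O
   replaces this matrix by O Q^T Q O^T, and the uniform distribution on the
   k-dimensional subspaces is the one that all orthogonal maps leave invariant. *)
Definition uniform_row_space (k m : nat)
    (Q : 'I_k -> 'I_m -> {RV P >-> R}) : Prop :=
  let proj w := (random_mx Q w)^T *m random_mx Q w in
  forall O : 'M[R]_m, O *m O^T = 1%:M ->
  forall B : set 'M[R]_m, <<s @open 'M[R]_m >> B ->
    P [set w | B (O *m proj w *m O^T)] = P [set w | B (proj w)].

Variant random_projector (k m : nat) (T : W -> 'M[R]_(k, m)) : Prop :=
| OrthogonalProjector (Q : 'I_k -> 'I_m -> {RV P >-> R}) of
    (k <= m)%N &
    (forall w, random_mx Q w *m (random_mx Q w)^T = 1%:M) &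
    uniform_row_space Q &
    (forall w, T w = Num.sqrt (m%:R / k%:R) *: random_mx Q w)
| GaussianProjector (U : 'I_k -> 'I_m -> {RV P >-> R}) of
    independent_entries U &
    (forall i j, standard_normal (U i j)) &
    (forall w, T w = (Num.sqrt k%:R)^-1 *: random_mx U w)
| RademacherProjector (U : 'I_k -> 'I_m -> {RV P >-> R}) of
    independent_entries U &
    (forall i j, rademacher (U i j)) &
    (forall w, T w = (Num.sqrt k%:R)^-1 *: random_mx U w)
| SparseProjector (U : 'I_k -> 'I_m -> {RV P >-> R}) of
    independent_entries U &
    (forall i j, sparse_sign (U i j)) &
    (forall w, T w = Num.sqrt (3 / k%:R) *: random_mx U w).

End RandomProjector.

(* Main.v *)
(* If [T] preserves up to [e] the scalar products of the direction of [ystar] with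
   the columns of [A] and with [b], then a point [x] feasible for the projected
   program satisfies [T A x = T b], so [ystar^T (A x - b)] is at least
   [- e (theta + 1) `|ystar|], and weak duality with [ystar] bounds the loss. The
   other inequality holds since [xstar] stays feasible.

   Polarization reduces scalar products to squared norms, whose tails follow from
   Chernoff bounds. When the entries are independent, every row of [T] gives a
   sub-Gaussian variable. For a random subspace only the invariance of its
   projection [Pi] is known: differentiating it along rotations and summing over
   the coordinate planes, with [Pi ^+ 2 = Pi] and [\tr Pi = k], gives a differential
   inequality for the moment generating function of an entry of [Pi]. *)
Require Import Defs.
From HB Require Import structures.
From mathcomp Require Import all_boot all_order all_algebra.
From mathcomp Require Import all_classical all_reals all_analysis.
From mathcomp Require Import measurable_realfun lebesgue_integral_under.
From mathcomp Require Import ring lra.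

Set Implicit Arguments.
Unset Strict Implicit.
Unset Printing Implicit Defensive.

Import Order.TTheory GRing.Theory Num.Theory.
Import numFieldNormedType.Exports.

Local Open Scope classical_set_scope.
Local Open Scope ring_scope.

(** The projectors with independent entries all enter through one class, [subgaussian], which asks
    for a Laplace transform bound and for the exact first two moments: unit variance cancels the
    first-order term in the moment generating function of a square, and so makes the failure
    exponent quadratic in the distortion. The entries of the subspace projector are dependent and
    admit no such product formula.

    The distortion actually used is [e0 = delta / (2 theta |ystar|)], for which the loss is at most
    [delta] because [theta + 1 <= 2 theta]; the [eps] of the statement is [e0 / theta]. From
    [delta <= |v(P)|], duality and Cauchy-Schwarz give [delta <= |ystar|], hence [e0 <= 1], the
    range of the Chernoff bounds. The columns and [- b] give [n + 1] scalar products with two norm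
    events each, and [2 (n + 1) <= 4 n].

    A last obstacle is measurability: the event concerns an infimum over uncountably many points,
    and monotonicity of the probability requires it to be measurable. Linear programming duality
    settles this as well. *)

Section Duality.
Variable R : realType.

(** * Scalar products, Farkas' lemma and linear programming duality *)

Lemma dotvE n (u v : 'cV[R]_n) : dotv u v = \sum_i u i 0 * v i 0.
Proof. by rewrite /dotv mxE; apply: eq_bigr => i _; rewrite mxE. Qed.

Lemma dotvC n (u v : 'cV[R]_n) : dotv u v = dotv v u.
Proof. by rewrite !dotvE; apply: eq_bigr => i _; rewrite mulrC. Qed.

Lemma dotvDl n (u v w : 'cV[R]_n) : dotv (u + v) w = dotv u w + dotv v w.
Proof. by rewrite /dotv linearD mulmxDl mxE. Qed.

Lemma dotvZl n a (u v : 'cV[R]_n) : dotv (a *: u) v = a * dotv u v.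
Proof. by rewrite /dotv linearZ -scalemxAl mxE. Qed.

Lemma dotvNl n (u v : 'cV[R]_n) : dotv (- u) v = - dotv u v.
Proof. by rewrite -scaleN1r dotvZl mulN1r. Qed.

Lemma dotvBl n (u v w : 'cV[R]_n) : dotv (u - v) w = dotv u w - dotv v w.
Proof. by rewrite dotvDl dotvNl. Qed.

Lemma dotvDr n (u v w : 'cV[R]_n) : dotv w (u + v) = dotv w u + dotv w v.
Proof. by rewrite !(dotvC w) dotvDl. Qed.

Lemma dotvZr n a (u v : 'cV[R]_n) : dotv v (a *: u) = a * dotv v u.
Proof. by rewrite !(dotvC v) dotvZl. Qed.

Lemma dotvNr n (u v : 'cV[R]_n) : dotv v (- u) = - dotv v u.
Proof. by rewrite !(dotvC v) dotvNl. Qed.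

Lemma dotvBr n (u v w : 'cV[R]_n) : dotv w (u - v) = dotv w u - dotv w v.
Proof. by rewrite !(dotvC w) dotvBl. Qed.

Lemma dotvv_ge0 n (u : 'cV[R]_n) : 0 <= dotv u u.
Proof. by rewrite dotvE; apply: sumr_ge0 => i _; rewrite -expr2 sqr_ge0. Qed.

Lemma dotvv_eq0 n (u : 'cV[R]_n) : (dotv u u == 0) = (u == 0).
Proof.
apply/idP/eqP => [|->]; last by rewrite dotvE big1// => i _; rewrite mxE mul0r.
rewrite dotvE psumr_eq0 => [/allP u0|i _]; last by rewrite -expr2 sqr_ge0.
apply/matrixP => i j; rewrite ord1 mxE; apply/eqP.
by have := u0 i (mem_index_enum _); rewrite mulf_eq0 orbb.
Qed.

Lemma dotv_mulmxl n p (M : 'M[R]_(p, n)) (u : 'cV[R]_n) (v : 'cV[R]_p) :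
  dotv (M *m u) v = dotv u (M^T *m v).
Proof. by rewrite /dotv trmx_mul mulmxA. Qed.

Lemma dotv_ge0 n (u v : 'cV[R]_n) :
  (forall i, 0 <= u i 0) -> (forall i, 0 <= v i 0) -> 0 <= dotv u v.
Proof. by move=> u0 v0; rewrite dotvE sumr_ge0// => i _; rewrite mulr_ge0. Qed.

Lemma dotv_col_mx n p (u1 v1 : 'cV[R]_n) (u2 v2 : 'cV[R]_p) :
  dotv (col_mx u1 u2) (col_mx v1 v2) = dotv u1 v1 + dotv u2 v2.
Proof. by rewrite /dotv tr_col_mx mul_row_col mxE. Qed.

Lemma enorm_ge0 n (u : 'cV[R]_n) : 0 <= enorm u.
Proof. exact: sqrtr_ge0. Qed.

Lemma sqr_enorm n (u : 'cV[R]_n) : enorm u ^+ 2 = dotv u u.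
Proof. by rewrite sqr_sqrtr// dotvv_ge0. Qed.

(* Bartl's proof: if [z] separates [b] from the columns of [A] but not from the
   additional column [a], recurse after projecting along [a] onto the orthogonal
   complement of [z]. *)
Lemma farkas n p (A : 'M[R]_(p, n)) (b : 'cV[R]_p) :
  (exists x : 'cV[R]_n, (forall j, 0 <= x j 0) /\ A *m x = b) \/
  (exists z : 'cV[R]_p, (forall j, (A^T *m z) j 0 <= 0) /\ 0 < dotv b z).
Proof.
elim: n A b => [|n IHn] A b.
  have [->|b0] := eqVneq b 0; [left|right].
    by exists 0; split => [[]//|]; rewrite mulmx0.
  by exists b; split => [[]//|]; rewrite lt0r dotvv_eq0 b0 dotvv_ge0.
change 'M[R]_(p, 1 + n) in A.
suff : (exists x : 'cV[R]_(1 + n), (forall j, 0 <= x j 0) /\ A *m x = b) \/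
  (exists z : 'cV[R]_p, (forall j, (A^T *m z) j 0 <= 0) /\ 0 < dotv b z) by [].
rewrite -(hsubmxK A); set a := lsubmx A; set B := rsubmx A.
have tr_rowP z (P : R -> Prop) : P (dotv a z) -> (forall j, P ((B^T *m z) j 0)) ->
    forall j, P (((row_mx a B)^T *m z) j 0).
  move=> Pa PB j; rewrite tr_row_mx mul_col_mx.
  case: (split_ordP j) => i ->; last by rewrite col_mxEd.
  by rewrite col_mxEu ord1.
have [[x [x0 Bx]]|[z [Bz bz]]] := IHn B b.
  left; exists (col_mx (0 : 'cV_1) x); split=> [j|]; last first.
    by rewrite mul_row_col mulmx0 add0r.
  by case: (split_ordP j) => i ->; rewrite ?col_mxEu ?col_mxEd// mxE.
have [az|az] := leP (dotv a z) 0.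
  by right; exists z; split=> //; apply: (tr_rowP z (fun t => t <= 0)).
pose H := 1%:M - (dotv a z)^-1 *: (a *m z^T).
have HE f : H *m f = f - (dotv a z)^-1 * dotv f z *: a.
  rewrite mulmxBl mul1mx -scalemxAl -mulmxA -scalerA.
  rewrite [z^T *m f]mx11_scalar mul_mx_scalar (_ : (z^T *m f) 0 0 = dotv f z)//.
  by rewrite dotvC.
have [[x [x0 Bx]]|[y [By b_y]]] := IHn (H *m B) (H *m b); last first.
  (* Since [H a = 0], the pulled back certificate is orthogonal to [a], and its products with the
     columns of [B] are those of [y] with [H B]. *)
  right; exists (H^T *m y); split; last by rewrite -dotv_mulmxl.
  apply: (tr_rowP (H^T *m y) (fun t => t <= 0)).
    by rewrite -dotv_mulmxl HE mulVf ?gt_eqF// scale1r subrr dotvC /dotv mulmx0 mxE.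
  by move=> j; rewrite mulmxA -trmx_mul.
(* [H B x = H b] says that [b - B x] is a multiple of [a]; pairing with [z] gives the coefficient,
   which is nonnegative because [z] separates [b] from the columns of [B]. *)
left; exists (col_mx (((dotv a z)^-1 * dotv (b - B *m x) z)%:M : 'cV_1) x); split.
  move=> j; case: (split_ordP j) => i ->; last by rewrite col_mxEd.
  rewrite col_mxEu ord1 mxE eqxx mulr1n mulr_ge0// ?invr_ge0 1?ltW//.
  rewrite dotvBl dotv_mulmxl subr_gt0.
  apply: le_lt_trans bz; rewrite -oppr_ge0 dotvC -dotvNl.
  by apply: dotv_ge0 => // l; rewrite mxE oppr_ge0.
move: Bx; rewrite -mulmxA !HE => /eqP; rewrite subr_eq => /eqP Bx.
rewrite mul_row_col mul_mx_scalar [X in _ + X]Bx dotvBl mulrBr scalerBl.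
by rewrite addrC -addrA subrKC subrK.
Qed.

(** Farkas is applied to [A x = b], [c^T x + s = r - eta] with [x, s >= 0], which is unsolvable as
    [r] is a lower bound. The certificate is a pair [(y, t)] with [t <= 0], and [y / (- t)] is the
    dual point. The slack [eta] avoids any claim that the dual optimum is attained. *)
Lemma lp_duality m n (A : 'M[R]_(m, n)) (b : 'cV[R]_m) (c : 'cV[R]_n) (r eta : R) :
  feasible A b !=set0 -> (forall x, feasible A b x -> r <= dotv c x) -> 0 < eta ->
  exists2 y, dual_feasible A c y & r - eta < dotv b y.
Proof.
move=> [x0 [Ax0 x0_ge0]] rP eta0.
pose M := col_mx (row_mx A 0) (row_mx c^T (1%:M : 'M[R]_1)).
have [[x [x_ge0 Mx]]|[z []]] := farkas M (col_mx b ((r - eta)%:M : 'M[R]_1)).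
  move: Mx; rewrite -(vsubmxK x) mul_col_mx !mul_row_col mul0mx addr0 mul1mx.
  move=> /eq_col_mx[Ax /matrixP/(_ 0 0)].
  have := rP (usubmx x); rewrite !mxE eqxx mulr1n => rx.
  have := x_ge0 (rshift n 0) => s0.
  have : r <= dotv c (usubmx x).
    by apply: rx; split=> // j; rewrite mxE.
  rewrite /dotv mxE; lra.
rewrite -(vsubmxK z); set y := usubmx z; set s := dsubmx z.
rewrite [s]mx11_scalar; set t := s 0 0.
rewrite tr_col_mx !tr_row_mx mul_row_col !mul_col_mx trmxK trmx0 trmx1 mul0mx mul1mx.
rewrite add_col_mx add0r mul_mx_scalar dotv_col_mx => zP.
rewrite {2}/dotv tr_scalar_mx -scalar_mxM mxE eqxx mulr1n => bz.
have Ay j : (A^T *m y) j 0 + t * c j 0 <= 0.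
  by have := zP (lshift 1 j); rewrite col_mxEu !mxE.
have : t <= 0 by have := zP (rshift n 0); rewrite col_mxEd mxE eqxx mulr1n.
(* If [t = 0], then [y] alone would certify that [A x = b], [x >= 0] is infeasible, against [x0]. *)
rewrite le_eqVlt => /orP[/eqP t0|t0].
  move: bz; rewrite t0 mulr0 addr0 -Ax0 dotv_mulmxl ltNge => /negP[].
  rewrite -oppr_ge0 dotvC -dotvNl; apply: dotv_ge0 => // j.
  by rewrite mxE oppr_ge0; have := Ay j; rewrite t0 mul0r addr0.
exists ((- t)^-1 *: y) => [j|]; last first.
  by rewrite dotvZr mulrC ltr_pdivlMr ?oppr_gt0//; lra.
rewrite -scalemxAr mxE mulrC ler_pdivrMr ?oppr_gt0//.
by have := Ay j; lra.
Qed.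

End Duality.

(** * Product formulas for functions of disjoint families of independent variables *)

Section Independence.
Context {d : measure_display} {W : measurableType d} {R : realType}.
Variable P : probability W R.

(** Independence determines the joint law on rectangles, so it is the product of the marginal laws,
    and Tonelli applies. *)
Lemma ge0_expectationM (f g : W -> R) :
  measurable_fun setT f -> measurable_fun setT g ->
  (forall w, 0 <= f w) -> (forall w, 0 <= g w) ->
  (forall A B, measurable A -> measurable B ->
    P (f @^-1` A `&` g @^-1` B) = (P (f @^-1` A) * P (g @^-1` B))%E) ->
  (\int[P]_w (f w * g w)%:E = (\int[P]_w (f w)%:E) * (\int[P]_w (g w)%:E))%E.
Proof.
move=> mf mg f0 g0 indep.
pose X : {RV P >-> R} := HB.pack f (@isMeasurableFun.Build _ _ _ _ f mf).
pose Y : {RV P >-> R} := HB.pack g (@isMeasurableFun.Build _ _ _ _ g mg).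
have mXY : measurable_fun setT
    (fun w => (f w, g w) : R * R).
  exact: measurable_fun_pair.
pose XY : {mfun W >-> (R * R)%type} :=
  HB.pack (fun w => (f w, g w)) (@isMeasurableFun.Build _ _ _ _ _ mXY).
pose D1 : probability R R := distribution P X.
pose D2 : probability R R := distribution P Y.
pose D12 : {measure set (R * R)%type -> \bar R} :=
  distribution P XY.
(* The absolute values make the integrand nonnegative on the whole plane, as Tonelli requires; on
   the values of [f] and [g] they change nothing. *)
pose norm2 (z : R * R) : \bar R := (`|z.1| * `|z.2|)%:E.
have mnorm2 : measurable_fun setT norm2.
  by apply/measurable_EFinP; apply: measurable_funM; apply: measurableT_comp.
transitivity (\int[D12]_z norm2 z)%E.
  rewrite ge0_integral_distribution//; last by move=> z; rewrite lee_fin.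
  by apply: eq_integral => w _ /=; rewrite /norm2 /= !ger0_norm.
transitivity (\int[D1 \x D2]_z norm2 z)%E.
  apply: eq_measure_integral => A mA _; apply/esym.
  have indepD B C : measurable B -> measurable C ->
    D12 (B `*` C) = (D1 B * D2 C)%E by exact: indep.
  exact: (product_measure_unique indepD mA).
rewrite fubini_tonelli1//; last by move=> z; rewrite lee_fin.
have mabs : measurable_fun [set: R] (fun x : R => `|x|%:E).
  by apply/measurable_EFinP; exact: normr_measurable.
have absE (Z : {RV P >-> R}) : (forall w, 0 <= Z w) ->
    (\int[distribution P Z]_y `|y|%:E = \int[P]_w (Z w)%:E)%E.
  move=> Z0; rewrite ge0_integral_distribution//.
  by apply: eq_integral => w _ /=; rewrite ger0_norm.
transitivity (\int[D1]_x (`|x|%:E * \int[P]_w (g w)%:E))%E.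
  apply: eq_integral => x _; rewrite /fubini_F /norm2 /=.
  under eq_integral do rewrite EFinM.
  by rewrite ge0_integralZl// (absE Y).
rewrite ge0_integralZr// ?(absE X)//.
by apply: integral_ge0 => w _; rewrite lee_fin.
Qed.

Context {I : finType}.
Variable X : I -> {RV P >-> R}.

(** A family closed under intersection that generates the sigma-algebra of the variables indexed by
    [J]; this is the form in which Dynkin's uniqueness argument can be used. *)
Definition cylinder (J : {set I}) : set (set W) :=
  [set \bigcap_(i in [set` J]) X i @^-1` B i | B in [set B : I -> set R |
    forall i, measurable (B i)]].

Lemma cylinder_measurable (J : {set I}) : cylinder J `<=` measurable.
Proof.
move=> _ [B mB <-]; apply: fin_bigcap_measurable; first exact: finite_finset.
by move=> i _; rewrite -[_ @^-1` _]setTI; exact: measurable_funPT.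
Qed.

Lemma cylinderT J : cylinder J setT.
Proof.
exists (fun=> setT) => //; rewrite -subTset => w _ i _ //.
Qed.

Lemma cylinderI J : setI_closed (cylinder J).
Proof.
move=> _ _ [B mB <-] [C mC <-]; exists (fun i => B i `&` C i).
  by move=> i /=; exact: measurableI.
by rewrite -bigcapI; apply: eq_bigcapr => i _; rewrite preimage_setI.
Qed.

Lemma sub_cylinder (J J' : {set I}) : J \subset J' -> cylinder J `<=` cylinder J'.
Proof.
move=> /fintype.subsetP JJ' _ [B mB <-].
exists (fun i => if i \in J then B i else setT).
  by move=> i /=; case: ifP.
apply/seteqP; split=> w Bw i /= iJ.
  by have := Bw i (JJ' _ iJ); rewrite /= iJ.
by case: ifPn => // iJ'; exact: Bw.
Qed.

Lemma cylinder_preimage (J : {set I}) i B : i \in J -> measurable B -> cylinder J (X i @^-1` B).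
Proof.
move=> iJ mB; exists (fun l => if l == i then B else setT).
  by move=> l /=; case: ifP.
apply/seteqP; split=> [w /(_ i iJ)|w Bw l _]; rewrite /= ?eqxx//.
by case: eqP => [->|].
Qed.

(** Encodes that [f] depends only on the variables indexed by [J], without exhibiting it as a
    function of them. *)
Definition measurable_wrt (J : {set I}) (f : W -> R) :=
  measurable_fun (setT : set (g_sigma_algebraType (cylinder J))) f.

Lemma measurable_wrt_var (J : {set I}) i : i \in J -> measurable_wrt J (X i).
Proof.
move=> iJ _ B mB; rewrite setTI.
by apply: sub_sigma_algebra; exact: cylinder_preimage.
Qed.

Lemma sub_measurable_wrt (J J' : {set I}) f :
  J \subset J' -> measurable_wrt J f -> measurable_wrt J' f.
Proof.
move=> JJ' mf _ B mB; have := mf measurableT B mB.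
apply: sub_smallest2r; last exact: sub_cylinder.
exact: smallest_sigma_algebra.
Qed.

Lemma measurable_wrtW J f : measurable_wrt J f -> measurable_fun setT f.
Proof.
move=> mf _ B mB; have := mf measurableT B mB.
apply: smallest_sub; first exact: sigma_algebra_measurable.
exact: cylinder_measurable.
Qed.

Hypothesis indepX : mutually_independent X.

(** The two families of sets are glued into one family [E] over the disjoint union of the indices,
    so that mutual independence factors all three probabilities. *)
Lemma cylinder_indep (J J' : {set I}) A B : [disjoint J & J']%B ->
  cylinder J A -> cylinder J' B -> P (A `&` B) = (P A * P B)%E.
Proof.
move=> JJ' [C mC <-] [D mD <-].
pose E i := if i \in J then C i else D i.
have mE i : measurable (E i) by rewrite /E; case: ifP.
have JE i : i \in J -> E i = C i by rewrite /E => ->.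
have J'E i : i \in J' -> E i = D i.
  by move=> iJ'; rewrite /E (disjointFl JJ' iJ').
have -> : \bigcap_(i in [set` J]) X i @^-1` C i =
    \bigcap_(i in [set` J]) X i @^-1` E i.
  by apply: eq_bigcapr => i /= iJ; rewrite JE.
have -> : \bigcap_(i in [set` J']) X i @^-1` D i =
    \bigcap_(i in [set` J']) X i @^-1` E i.
  by apply: eq_bigcapr => i /= iJ; rewrite J'E.
rewrite -bigcap_setU (_ : [set` J] `|` [set` J'] = [set` J :|: J']); last first.
  apply/seteqP; split=> i /=; rewrite inE; first by case=> ->; rewrite ?orbT.
  by move=> /orP.
rewrite !indepX// (eq_bigl [predU J & J']) => [|i]; last by rewrite !inE.
by rewrite bigU.
Qed.

Lemma sigma_cylinder_indep (J J' : {set I}) A B : [disjoint J & J']%B ->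
  <<s cylinder J >> A -> <<s cylinder J' >> B -> P (A `&` B) = (P A * P B)%E.
Proof.
move=> JJ'.
(* For fixed [C], both sides are finite measures in [D]. They agree on the cylinders, hence on the
   generated sigma-algebra; using this once in each argument extends independence from cylinders. *)
have half (K : set (set W)) (L : {set I}) C : measurable C ->
    (forall D, cylinder L D -> P (D `&` C) = (P D * P C)%E) ->
    forall D, <<s cylinder L >> D -> P (D `&` C) = (P D * P C)%E.
  move=> mC PD D sD.
  have c0 : 0 <= fine (P C) by rewrite fine_ge0.
  have scaleE E : mscale (NngNum c0) P E = (P E * P C)%E.
    by rewrite /mscale /= fineK ?fin_num_measure// muleC.
  pose m1 : {measure set W -> \bar R} := mrestr P mC.
  pose m2 : {measure set W -> \bar R} := mscale (NngNum c0) P.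
  rewrite -scaleE -[P (D `&` C)]/(m1 D) -/m2.
  apply: (@g_sigma_algebra_measure_unique _ _ _ (cylinder L) _ (fun=> setT) _ _ m1 m2)
    => //.
  - exact: cylinder_measurable.
  - by move=> _; exact: cylinderT.
  - by rewrite bigcup_const.
  - exact: cylinderI.
  - by move=> E /PD PE; rewrite -[RHS]/(mscale (NngNum c0) P E) scaleE -PE.
  - by move=> _; rewrite /m1 /= /mrestr setTI ltey_eq fin_num_measure.
have sub L : <<s cylinder L >> `<=` measurable.
  apply: smallest_sub; first exact: sigma_algebra_measurable.
  exact: cylinder_measurable.
move=> sA sB; apply: (half setT J) => //; first exact: sub sB.
move=> {sA}A cA; rewrite setIC muleC; apply: (half setT J') => //.
  exact: cylinder_measurable cA.
move=> {sB}B cB; rewrite setIC muleC; exact: (cylinder_indep JJ').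
Qed.

Lemma ge0_expectationM_wrt (J J' : {set I}) (f g : W -> R) : [disjoint J & J']%B ->
  measurable_wrt J f -> measurable_wrt J' g ->
  (forall w, 0 <= f w) -> (forall w, 0 <= g w) ->
  (\int[P]_w (f w * g w)%:E = (\int[P]_w (f w)%:E) * (\int[P]_w (g w)%:E))%E.
Proof.
move=> JJ' mf mg f0 g0; apply: ge0_expectationM => //.
- exact: measurable_wrtW mf.
- exact: measurable_wrtW mg.
move=> A B mA mB; apply: (sigma_cylinder_indep JJ').
- by rewrite -[_ @^-1` _]setTI; exact: mf.
- by rewrite -[_ @^-1` _]setTI; exact: mg.
Qed.

(** By induction: the remaining factors depend on the union of their index sets, which is disjoint
    from the index set of the first factor. *)
Lemma ge0_expectation_prod {L : finType} (J : L -> {set I}) (f : L -> W -> R) :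
  (forall k l, k != l -> [disjoint J k & J l]%B) ->
  (forall l, measurable_wrt (J l) (f l)) -> (forall l w, 0 <= f l w) ->
  (\int[P]_w (\prod_l f l w)%:E = \prod_l \int[P]_w (f l w)%:E)%E.
Proof.
move=> disjJ mf f0.
suff H s : uniq s -> (\int[P]_w (\prod_(l <- s) f l w)%:E =
    \prod_(l <- s) \int[P]_w (f l w)%:E)%E by apply: H; exact: index_enum_uniq.
elim: s => [_|l s IHs /= /andP[ls us]].
  under eq_integral do rewrite big_nil.
  by rewrite big_nil integral_cst//= probability_setT mule1.
under eq_integral do rewrite big_cons.
rewrite big_cons -IHs//.
apply: (ge0_expectationM_wrt (J := J l) (J' := \bigcup_(k in s) J k)%SET) => //.
- rewrite finset.bigcup_disjoint => // k ks; apply: disjJ.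
  by apply: contraNneq ls => ->.
- apply: measurable_prod => k ks; apply: sub_measurable_wrt (mf k).
  exact: finset.bigcup_sup.
- by move=> w; exact: prodr_ge0.
Qed.

End Independence.

(** * Elementary bounds on the exponential *)

Section RealIneqs.
Variable R : realType.

Lemma expR_quadratic_ub (y : R) : expR y <= 1 + y + y ^+ 2 * expR `|y|.
Proof.
have [y0|y0] := leP 0 y.
  rewrite ger0_norm//.
  have h : expR y - 1 <= y * expR y.
    have : (1 - y) * expR y <= expR (- y) * expR y.
      by rewrite ler_pM2r ?expR_gt0// expR_ge1Dx.
    rewrite -expRD addNr expR0; lra.
  have : y * (expR y - 1) <= y * (y * expR y) by rewrite ler_wpM2l.
  lra.
rewrite ltr0_norm//.
have h1 : 1 <= expR (- y) by rewrite -[X in X <= _]expR0 ler_expR; lra.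
have h2 : 1 - y <= expR (- y) by exact: expR_ge1Dx.
have h3 : expR y * expR (- y) = 1 by rewrite -expRD subrr expR0.
have h4 : 0 < expR y by exact: expR_gt0.
have h5 : expR y * (1 - y) <= 1 by have := ler_wpM2l (ltW h4) h2; rewrite h3.
have h6 : y ^+ 2 <= y ^+ 2 * expR (- y) by rewrite ler_peMr// sqr_ge0.
nra.
Qed.

Lemma sqr_le_expR (z : R) : 0 <= z -> z ^+ 2 <= 4 * expR z.
Proof.
move=> z0; have h : z / 2 <= expR (z / 2) by apply: le_trans (expR_ge1Dx _); lra.
have -> : expR z = expR (z / 2) ^+ 2 by rewrite expr2 -expRD; congr expR; lra.
have : (z / 2) ^+ 2 <= expR (z / 2) ^+ 2 by rewrite lerXn2r// nnegrE ?expR_ge0//; lra.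
nra.
Qed.

(** The linear term in [x ^+ 2] is kept exact so that it cancels in expectation. The remainder
    carries two factors [exp (|z| / 96)], one from [|l| <= 1 / 96] and one absorbing [z ^+ 2];
    together they give the exponent [1 / 48]. *)
Lemma expR_mulN_le_quadratic (l x : R) : `|l| <= 1 / 96 ->
  expR (l * (x ^+ 2 - 1)) <=
  1 - l + l * x ^+ 2 + 4 * 96 ^+ 2 * l ^+ 2 * expR (1 / 48) * expR (x ^+ 2 / 48).
Proof.
move=> l96; set z := x ^+ 2 - 1.
have z1 : `|z| <= x ^+ 2 + 1.
  by rewrite /z (le_trans (ler_normB _ _))// normr1 ger0_norm// sqr_ge0.
apply: le_trans (expR_quadratic_ub _) _.
rewrite -(addrA (1 - l)).
have -> : 1 + l * z + (l * z) ^+ 2 * expR `|l * z| =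
  1 - l + (l * x ^+ 2 + (l * z) ^+ 2 * expR `|l * z|) by rewrite /z; ring.
rewrite lerD2l lerD2l exprMn.
have z2 : z ^+ 2 <= 4 * 96 ^+ 2 * expR (`|z| / 96).
  have : (`|z| / 96) ^+ 2 <= 4 * expR (`|z| / 96) by apply: sqr_le_expR; rewrite divr_ge0.
  rewrite expr_div_n real_normK ?num_real//; nra.
have lz : expR `|l * z| <= expR (`|z| / 96).
  by rewrite ler_expR normrM; have := ler_wpM2r (normr_ge0 z) l96; lra.
have E2 : expR (`|z| / 96) * expR (`|z| / 96) <= expR (1 / 48) * expR (x ^+ 2 / 48).
  by rewrite -!expRD ler_expR; lra.
have l0 : 0 <= l ^+ 2 by exact: sqr_ge0.
have e0 := expR_ge0 `|l * z|; have e1 := expR_ge0 (`|z| / 96).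
have : z ^+ 2 * expR `|l * z| <= 4 * 96 ^+ 2 * (expR (1 / 48) * expR (x ^+ 2 / 48)).
  apply: le_trans (_ : 4 * 96 ^+ 2 * (expR (`|z| / 96) * expR (`|z| / 96)) <= _).
    rewrite mulrA; apply: ler_pM => //; exact: sqr_ge0.
  by rewrite ler_pM2l//; lra.
move=> /(ler_wpM2l l0); lra.
Qed.

End RealIneqs.

(** * Sub-Gaussian variables and the moment generating function of their squares *)

Section Subgaussian.
Context {d : measure_display} {W : measurableType d} {R : realType}.
Variable P : probability W R.
Implicit Types X Y f g : W -> R.

Lemma integrable_dominated f g : measurable_fun setT f ->
  (forall w, `|f w| <= g w) -> P.-integrable setT (EFin \o g) ->
  P.-integrable setT (EFin \o f).
Proof.
move=> mf fg; apply: le_integrable => //; first exact/measurable_EFinP.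
by move=> w _ /=; rewrite lee_fin (le_trans (fg w))// ler_norm.
Qed.

Lemma ge0_integrable f : measurable_fun setT f -> (forall w, 0 <= f w) ->
  (\int[P]_w (f w)%:E < +oo)%E -> P.-integrable setT (EFin \o f).
Proof.
move=> mf f0 foo; apply/integrableP; split; first exact/measurable_EFinP.
by under eq_integral do rewrite /= ger0_norm//.
Qed.

Lemma integrable_scaler k f : P.-integrable setT (EFin \o f) ->
  P.-integrable setT (EFin \o (fun w => k * f w)).
Proof. by move=> fi; apply: eq_integrable (integrableZl measurableT k fi). Qed.

Lemma integrable_addr f g : P.-integrable setT (EFin \o f) ->
  P.-integrable setT (EFin \o g) ->
  P.-integrable setT (EFin \o (fun w => f w + g w)).
Proof. by move=> fi gi; apply: eq_integrable (integrableD measurableT fi gi). Qed.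

Lemma integral_scaler k f : P.-integrable setT (EFin \o f) ->
  (\int[P]_w (k * f w)%:E = k%:E * \int[P]_w (f w)%:E)%E.
Proof.
by move=> fi; rewrite -(integralZl measurableT fi); apply: eq_integral => w _.
Qed.

Lemma integral_addr f g : P.-integrable setT (EFin \o f) ->
  P.-integrable setT (EFin \o g) ->
  (\int[P]_w (f w + g w)%:E = \int[P]_w (f w)%:E + \int[P]_w (g w)%:E)%E.
Proof.
by move=> fi gi; rewrite -(integralD measurableT fi gi); apply: eq_integral => w _.
Qed.

(* [q] is the exact variance; the factor [2] is loose enough for the sparse
   signs. *)
Definition subgaussian (q : R) X :=
  [/\ measurable_fun setT X,
      forall s, (\int[P]_w (expR (s * X w))%:E <= (expR (2 * s ^+ 2 * q))%:E)%E,
      (\int[P]_w (X w ^+ 2)%:E = q%:E)%E &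
      (\int[P]_w (X w)%:E = 0)%E].

Lemma subgaussian_sqr_integrable q X : subgaussian q X ->
  P.-integrable setT (EFin \o (fun w => X w ^+ 2)).
Proof.
move=> [mX _ X2 _]; apply: ge0_integrable.
- exact: measurable_funX.
- by move=> w; exact: sqr_ge0.
- by rewrite X2 ltry.
Qed.

Lemma subgaussian_integrable q X : subgaussian q X ->
  P.-integrable setT (EFin \o X).
Proof.
move=> sX; have [mX _ _ _] := sX.
apply: (@integrable_dominated X (fun w => X w ^+ 2 + 1)) => //.
  move=> w; have := sqr_ge0 (`|X w| - 1).
  rewrite sqrrB real_normK ?num_real// expr1n mulr1.
  have := sqr_ge0 (X w); lra.
apply: integrable_addr; first exact: subgaussian_sqr_integrable sX.
exact: finite_measure_integrable_cst.
Qed.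

(** The sum of the geometric series with first term [2 exp (1 / 24)] and ratio [exp (- 1 / 16)]. *)
Definition gauss_const : R := 2 * expR (1 / 24) / (1 - expR (- (1 / 16))).

Lemma gauss_const_ge1 : 1 <= gauss_const.
Proof.
have h1 : expR (- (1 / 16)) < 1 :> R by rewrite -[X in _ < X]expR0 ltr_expR; lra.
have h2 : 0 < expR (- (1 / 16)) :> R by exact: expR_gt0.
have h3 : 1 <= expR (1 / 24) :> R by rewrite -[X in X <= _]expR0 ler_expR; lra.
by rewrite /gauss_const ler_pdivlMr; lra.
Qed.

(* With [n] the integer part of [|x|], the [n]-th summand alone dominates the
   left-hand side. *)
Lemma expR_sqr_le_series (x : R) :
  ((expR (x ^+ 2 / 48))%:E <= \sum_(n <oo)
   (expR (n.+1%:R ^+ 2 / 48 - n%:R ^+ 2 / 3) *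
    (expR (n%:R / 3 * x) + expR (- (n%:R / 3) * x)))%:E)%E.
Proof.
pose u (n : nat) : \bar R := (expR (n.+1%:R ^+ 2 / 48 - n%:R ^+ 2 / 3) *
    (expR (n%:R / 3 * x) + expR (- (n%:R / 3) * x)))%:E.
pose n := Num.trunc `|x|.
have /andP[nx xn] : (n%:R <= `|x| < n.+1%:R)%R by exact: truncn_itv.
have u0 k : (0 <= u k)%E by rewrite lee_fin mulr_ge0 ?addr_ge0 ?expR_ge0.
apply: (@le_trans _ _ (u n)); last first.
  apply: (@le_trans _ _ (\sum_(0 <= i < n.+1) u i)%E); last exact: nneseries_lim_ge.
  by rewrite big_nat_recr//= leeDr// sume_ge0.
rewrite lee_fin.
have xE : expR (n%:R / 3 * `|x|) <= expR (n%:R / 3 * x) + expR (- (n%:R / 3) * x).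
  have [x0|x0] := leP 0 x.
    by rewrite ger0_norm// lerDl expR_ge0.
  by rewrite ltr0_norm// mulrN mulNr lerDr expR_ge0.
apply: le_trans (_ : expR (n.+1%:R ^+ 2 / 48 - n%:R ^+ 2 / 3) *
  expR (n%:R / 3 * `|x|) <= _); last by rewrite ler_pM2l ?expR_gt0.
rewrite -expRD ler_expR.
have h1 : x ^+ 2 <= n.+1%:R ^+ 2.
  by rewrite -real_normK ?num_real// lerXn2r ?nnegrE// ltW.
have h2 : n%:R * n%:R <= n%:R * `|x| by rewrite ler_wpM2l.
rewrite expr2 in h1 *; rewrite !expr2 in h1 *; lra.
Qed.

(** The series is integrated termwise with the Laplace bound at [s = n / 3] and [s = - n / 3]. The
    exponent of the [n]-th term becomes [(n + 1) ^+ 2 / 48 - n ^+ 2 / 9], which is at most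
    [1 / 24 - n / 16], so a geometric series dominates. *)
Lemma subgaussian_expR_sqr X : subgaussian 1 X ->
  (\int[P]_w (expR (X w ^+ 2 / 48))%:E <= gauss_const%:E)%E.
Proof.
move=> [mX sX _ _].
have mE (a : R) : measurable_fun setT (fun w => expR (a * X w)).
  by apply: measurableT_comp => //; exact: measurable_funM.
pose a (n : nat) : R := expR (n.+1%:R ^+ 2 / 48 - n%:R ^+ 2 / 3).
pose u (n : nat) w : \bar R :=
  (a n * (expR (n%:R / 3 * X w) + expR (- (n%:R / 3) * X w)))%:E.
have mu n : measurable_fun setT (u n).
  by apply/measurable_EFinP; apply: measurable_funM => //; exact: measurable_funD.
have u0 n w : (0 <= u n w)%E by rewrite lee_fin mulr_ge0 ?addr_ge0 ?expR_ge0.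
apply: (@le_trans _ _ (\int[P]_w (\sum_(n <oo) u n w))%E).
  apply: ge0_le_integral => //.
  - apply/measurable_EFinP; apply: measurableT_comp => //.
    by apply: measurable_funM => //; exact: measurable_funX.
  - exact: ge0_emeasurable_sum.
  - by move=> w _; exact: expR_sqr_le_series.
rewrite integral_nneseries//.
pose q : R := expR (- (1 / 16)).
have q1 : q < 1 by rewrite /q -[X in _ < X]expR0 ltr_expR; lra.
have q0 : 0 <= q by exact: expR_ge0.
apply: (@le_trans _ _ (\sum_(n <oo) (2 * expR (1 / 24) * q ^+ n)%:E)%E).
  apply: lee_nneseries => n _; first by move=> _; exact: integral_ge0.
  rewrite /u; under eq_integral do rewrite EFinM EFinD.
  rewrite ge0_integralZl//; last 3 first.
  - by apply: emeasurable_funD; exact/measurable_EFinP.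
  - by move=> w _; rewrite -EFinD lee_fin addr_ge0 ?expR_ge0.
  - by rewrite lee_fin expR_ge0.
  rewrite (@ge0_integralD _ _ _ P _ measurableT (fun w => (expR (n%:R / 3 * X w))%:E)
    (fun w => (expR (- (n%:R / 3) * X w))%:E))//; last 2 first.
  - exact/measurable_EFinP.
  - exact/measurable_EFinP.
  apply: (@le_trans _ _ ((a n)%:E * ((expR (2 * (n%:R / 3) ^+ 2 * 1))%:E +
      (expR (2 * (- (n%:R / 3)) ^+ 2 * 1))%:E)))%E.
    rewrite lee_pmul2l//; last by rewrite lte_fin expR_gt0.
    by apply: leeD; exact: sX.
  rewrite -EFinD -EFinM lee_fin sqrrN /a.
  have xyy (x y : R) : x * (y + y) = 2 * (x * y) by ring.
  rewrite xyy -[leRHS]mulrA ler_pM2l// /q -expRD -expRM_natl -expRD ler_expR.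
  have nn : n%:R <= n%:R ^+ 2 :> R.
    by rewrite -natrX ler_nat; case: (n) => // k; rewrite -mulnn leq_pmull.
  rewrite -(natr1 n).
  have := sqr_ge0 (n%:R - 1 : R); nra.
apply: lime_le.
  by apply: is_cvg_nneseries => n _ _; rewrite lee_fin !mulr_ge0 ?expR_ge0// exprn_ge0.
apply: nearW => n; rewrite sumEFin lee_fin.
have -> : \sum_(0 <= i < n) 2 * expR (1 / 24) * q ^+ i =
    series (geometric (2 * expR (1 / 24)) q) n by [].
rewrite geometric_seriesE ?lt_eqF//= /gauss_const -/q ler_pM2r ?invr_gt0 ?subr_gt0//.
by rewrite ler_piMr ?mulr_ge0 ?expR_ge0// gerBl exprn_ge0.
Qed.

Definition chi_const : R := 4 * 96 ^+ 2 * expR (1 / 48) * gauss_const.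

(** The value 48 keeps the Chernoff parameter [eps / (2 chi_const)] below [1 / 96] for [eps <= 1];
    it also makes the rate [1 / (4 chi_const)] weaker than the rate [1 / 8] of random subspaces. *)
Lemma chi_const_ge48 : 48 <= chi_const.
Proof.
have h1 : 1 <= expR (1 / 48) :> R by rewrite -[X in X <= _]expR0 ler_expR; lra.
have h2 := gauss_const_ge1.
have : 1 <= expR (1 / 48) * gauss_const by rewrite mulr_ege1.
rewrite /chi_const; lra.
Qed.

(** In expectation the terms [- l] and [l * X ^+ 2] cancel because the variance is 1, leaving
    [1 + chi_const * l ^+ 2]. *)
Lemma subgaussian_mgf_sqr X (l : R) : subgaussian 1 X -> `|l| <= 1 / 96 ->
  (\int[P]_w (expR (l * (X w ^+ 2 - 1)))%:E <= (expR (chi_const * l ^+ 2))%:E)%E.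
Proof.
move=> sX l96; have [mX _ X2 _] := sX.
have mX2 : measurable_fun setT (fun w => X w ^+ 2) by exact: measurable_funX.
have mE : measurable_fun setT (fun w => expR (X w ^+ 2 / 48)).
  by apply: measurableT_comp => //; exact: measurable_funM.
have iX2 := subgaussian_sqr_integrable sX.
have Eoo := subgaussian_expR_sqr sX.
have iE : P.-integrable setT (EFin \o (fun w => expR (X w ^+ 2 / 48))).
  apply: ge0_integrable => //.
  exact: le_lt_trans Eoo (ltry _).
pose c : R := 4 * 96 ^+ 2 * l ^+ 2 * expR (1 / 48).
have c0 : 0 <= c.
  by rewrite /c mulr_ge0 ?expR_ge0// mulr_ge0 ?sqr_ge0//; lra.
pose g w := (1 - l) + (l * X w ^+ 2 + c * expR (X w ^+ 2 / 48)).
have i1 : P.-integrable setT (EFin \o (fun=> 1 - l)).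
  exact: finite_measure_integrable_cst.
have i2 := integrable_scaler l iX2.
have i3 := integrable_scaler c iE.
have i23 := integrable_addr i2 i3.
apply: (@le_trans _ _ (\int[P]_w (g w)%:E)%E).
  apply: ge0_le_integral => //.
  - apply/measurable_EFinP; apply: measurableT_comp => //.
    by apply: measurable_funM => //; exact: measurable_funB.
  - by apply/measurable_EFinP; do 3?[apply: measurable_funD => //]; apply: measurable_funM.
  - move=> w _; rewrite lee_fin; apply: le_trans (expR_mulN_le_quadratic _ l96) _.
    by rewrite -addrA.
rewrite /g (integral_addr i1 i23) (integral_addr i2 i3) !integral_scaler//.
rewrite X2 mule1 integral_cst//= probability_setT mule1.
apply: (@le_trans _ _ ((1 - l)%:E + (l%:E + c%:E * gauss_const%:E)))%E.
  by rewrite !leeD2l// lee_wpmul2l// lee_fin.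
rewrite -EFinM -!EFinD lee_fin addrA subrK.
apply: le_trans (expR_ge1Dx _).
by rewrite lerD2l (_ : c * _ = chi_const * l ^+ 2)// /c /chi_const; ring.
Qed.

Lemma chernoff_bound f (a b : R) : measurable_fun setT f ->
  (\int[P]_w (expR (f w))%:E <= (expR a)%:E)%E ->
  (P [set w | (b <= f w)%R] <= (expR (a - b))%:E)%E.
Proof.
move=> mf fa.
pose X : {RV P >-> R} := HB.pack f (@isMeasurableFun.Build _ _ _ _ f mf).
apply: (le_trans (chernoff X b ltr01)).
rewrite mul1r expRD EFinM lee_wpmul2r ?lee_fin ?expR_ge0//.
rewrite /mmt_gen_fun unlock; apply: le_trans fa.
by under eq_integral do rewrite /= mulr1.
Qed.

End Subgaussian.

Arguments chi_const : clear implicits.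

(** * Linear combinations of independent sub-Gaussian entries *)

Section SubgaussianRows.
Context {d : measure_display} {W : measurableType d} {R : realType}.
Variable P : probability W R.
Context {I : finType}.
Variable X : I -> {RV P >-> R}.
Hypothesis indepX : mutually_independent X.
Local Notation measurable_wrt := (measurable_wrt X).

(** The product formula is known for nonnegative functions, so [f] is split into its positive and
    negative parts. These have equal finite integrals, and multiplying both by the integral of [g]
    preserves the equality. *)
Lemma expectationM_wrt_eq0 (J J' : {set I}) (f g : W -> R) : [disjoint J & J']%B ->
  measurable_wrt J f -> measurable_wrt J' g -> (forall w, 0 <= g w) ->
  P.-integrable setT (EFin \o f) -> P.-integrable setT (EFin \o g) ->
  (\int[P]_w (f w)%:E = 0)%E -> (\int[P]_w (f w * g w)%:E = 0)%E.
Proof.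
move=> JJ' mf mg g0 fi gi.
have posE (h : W -> R) : (EFin \o h)^\+%E = (fun w : W => (Num.max (h w) 0)%:E).
  by apply/funext => w; rewrite funeposE/= -EFin_max.
have negE (h : W -> R) : (EFin \o h)^\-%E = (fun w : W => (Num.max (- h w) 0)%:E).
  by apply/funext => w; rewrite funenegE/= -EFin_max.
have poo := integral_funepos_lt_pinfty measurableT fi.
have noo := integral_funeneg_lt_pinfty measurableT fi.
rewrite posE in poo; rewrite negE in noo.
rewrite integralE -[X in (\int[_]_(_ in _) X^\+ _)%E]/(EFin \o f).
rewrite -[X in (\int[_]_(_ in _) X^\- _)%E]/(EFin \o f) posE negE.
set p := (\int[P]_w (Num.max (f w) 0)%:E)%E in poo *.
set n := (\int[P]_w (Num.max (- f w) 0)%:E)%E in noo *.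
have pfin : p \is a fin_num.
  by rewrite ge0_fin_numE// integral_ge0// => w _; rewrite lee_fin le_max lexx orbT.
have nfin : n \is a fin_num.
  by rewrite ge0_fin_numE// integral_ge0// => w _; rewrite lee_fin le_max lexx orbT.
move/eqP; rewrite sube_eq ?add0e//.
move=> /eqP pn.
rewrite integralE -[X in (\int[_]_(_ in _) X^\+ _)%E]/(EFin \o (fun w => f w * g w)).
rewrite -[X in (\int[_]_(_ in _) X^\- _)%E]/(EFin \o (fun w => f w * g w)) posE negE.
have maxM (x y : R) : 0 <= y -> Num.max (x * y) 0 = Num.max x 0 * y.
  by move=> y0; rewrite maxr_pMl// mul0r.
under eq_integral do rewrite maxM//.
under [X in (_ - X)%E]eq_integral do rewrite -mulNr maxM//.
rewrite !(ge0_expectationM_wrt indepX JJ')//.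
- rewrite -/p -/n pn subee// fin_numM// -?pn//.
  exact: integral_fune_fin_num.
- by apply: measurable_maxr => //; exact: measurableT_comp.
- by move=> w; rewrite le_max lexx orbT.
- exact: measurable_maxr.
- by move=> w; rewrite le_max lexx orbT.
Qed.

(** The other factor is now signed too: both parts of [g] fall under [expectationM_wrt_eq0].
    Integrability comes from [|f g| <= f ^+ 2 + g ^+ 2]. *)
Lemma subgaussian_uncorrelated (J J' : {set I}) q q' (f g : W -> R) :
  [disjoint J & J']%B -> measurable_wrt J f -> measurable_wrt J' g ->
  subgaussian P q f -> subgaussian P q' g ->
  P.-integrable setT (EFin \o (fun w => f w * g w)) /\
  (\int[P]_w (f w * g w)%:E = 0)%E.
Proof.
move=> JJ' mf mg sf sg.
have if2 := subgaussian_sqr_integrable sf.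
have ig2 := subgaussian_sqr_integrable sg.
have [mf' _ _ f0] := sf; have [mg' _ _ _] := sg.
have fi := subgaussian_integrable sf; have gi := subgaussian_integrable sg.
have fg_int (h : W -> R) : measurable_fun setT h -> (forall w, `|h w| <= `|g w|) ->
    P.-integrable setT (EFin \o (fun w => f w * h w)).
  move=> mh hg; apply: (integrable_dominated _ _ (integrable_addr if2 ig2)).
    exact: measurable_funM.
  move=> w; rewrite normrM -(real_normK (num_real (f w))) -(real_normK (num_real (g w))).
  have := hg w; have := normr_ge0 (f w); have := normr_ge0 (g w).
  have := sqr_ge0 (`|f w| - `|g w|); have := sqr_ge0 (`|f w| + `|g w|); nra.
split; first exact: fg_int.
have mgp : measurable_wrt J' (fun w => Num.max (g w) 0) by exact: measurable_maxr.
have mgn : measurable_wrt J' (fun w => Num.max (- g w) 0).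
  by apply: measurable_maxr => //; exact: measurableT_comp.
have gp_le w : `|Num.max (g w) 0| <= `|g w|.
  by rewrite ger0_norm ?le_max ?lexx ?orbT// ge_max ler_norm normr_ge0.
have gn_le w : `|Num.max (- g w) 0| <= `|g w|.
  by rewrite ger0_norm ?le_max ?lexx ?orbT// ge_max -normrN ler_norm normr_ge0.
have gabs : P.-integrable setT (EFin \o (fun w => `|g w|)).
  exact: (integrable_norm gi).
have gpi : P.-integrable setT (EFin \o (fun w => Num.max (g w) 0)).
  by apply: (integrable_dominated _ gp_le gabs); exact: measurable_wrtW mgp.
have gni : P.-integrable setT (EFin \o (fun w => Num.max (- g w) 0)).
  by apply: (integrable_dominated _ gn_le gabs); exact: measurable_wrtW mgn.
have h0 (x : R) : 0 <= Num.max x 0 by rewrite le_max lexx orbT.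
transitivity (\int[P]_w (f w * Num.max (g w) 0 +
    -1 * (f w * Num.max (- g w) 0))%:E)%E.
  apply: eq_integral => w _; congr EFin; rewrite mulN1r -mulrBr; congr (_ * _).
  have [g0|g0] := leP 0 (g w); first by rewrite max_r ?oppr_le0// subr0.
  by rewrite max_l ?oppr_ge0 1?ltW// sub0r opprK.
have i1 := fg_int _ (measurable_wrtW mgp) gp_le.
have i2 := fg_int _ (measurable_wrtW mgn) gn_le.
rewrite (integral_addr i1 (integrable_scaler _ i2)) (integral_scaler _ i2).
by rewrite !(expectationM_wrt_eq0 JJ')// mule0 adde0.
Qed.

Lemma subgaussian0 : subgaussian P 0 (fun=> 0).
Proof.
split=> // [s||]; last 2 first.
- by rewrite expr0n/= integral0.
- by rewrite integral0.
by rewrite mulr0 expR0 mulr0 expR0 integral_cst//= probability_setT mule1.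
Qed.

(** The exponents [2 s ^+ 2 q] add up exactly like the variances, so a single parameter [q] serves
    for both. The coefficient [a] on one side only gives the induction step for weighted sums. *)
Lemma subgaussianD (J J' : {set I}) q q' a (f g : W -> R) :
  [disjoint J & J']%B -> measurable_wrt J f -> measurable_wrt J' g ->
  subgaussian P q f -> subgaussian P q' g ->
  subgaussian P (a ^+ 2 * q + q') (fun w => a * f w + g w).
Proof.
move=> JJ' mf mg sf sg.
have [ifg fg0] := subgaussian_uncorrelated JJ' mf mg sf sg.
have if2 := subgaussian_sqr_integrable sf.
have ig2 := subgaussian_sqr_integrable sg.
have fi := subgaussian_integrable sf; have gi := subgaussian_integrable sg.
have [mf' ef f2 f0] := sf; have [mg' eg g2 g0] := sg.
split.
- by apply: measurable_funD => //; exact: measurable_funM.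
- move=> s.
  have me h c L : measurable_wrt L h -> measurable_wrt L (fun w => expR (c * h w)).
    by move=> mh; apply: measurableT_comp => //; exact: measurable_funM.
  under eq_integral do rewrite mulrDr expRD mulrA.
  rewrite (ge0_expectationM_wrt indepX JJ' (me _ _ _ mf) (me _ _ _ mg)); last 2 first.
  - by move=> w; exact: expR_ge0.
  - by move=> w; exact: expR_ge0.
  apply: (@le_trans _ _ ((expR (2 * (s * a) ^+ 2 * q))%:E *
      (expR (2 * s ^+ 2 * q'))%:E)%E).
    by apply: lee_pmul => //; apply: integral_ge0 => w _; rewrite lee_fin expR_ge0.
  by rewrite -EFinM -expRD lee_fin ler_expR le_eqVlt; apply/orP; left; apply/eqP; ring.
- transitivity (\int[P]_w (a ^+ 2 * f w ^+ 2 + (2 * a * (f w * g w) + g w ^+ 2))%:E)%E.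
    by apply: eq_integral => w _; congr EFin; ring.
  rewrite (integral_addr (integrable_scaler _ if2))//; last first.
    exact/integrable_addr/ig2/integrable_scaler.
  rewrite (integral_addr (integrable_scaler _ ifg))// !integral_scaler//.
  by rewrite fg0 mule0 add0e f2 g2 -EFinM -EFinD.
- by rewrite (integral_addr (integrable_scaler _ fi))// integral_scaler// f0 g0 mule0 add0e.
Qed.

Variable V : I -> W -> R.
Hypothesis mV : forall i, measurable_wrt [set i]%SET (V i).
Hypothesis subV : forall i, subgaussian P 1 (V i).

(** The map [h] selects one row of the matrix of entries. Its image is recorded because independence
    of distinct rows is needed afterwards. *)
Lemma subgaussian_sum {L : finType} (h : L -> I) (u : L -> R) : injective h ->
  measurable_wrt (h @: [set: L])%SET (fun w => \sum_l u l * V (h l) w) /\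
  subgaussian P (\sum_l u l ^+ 2) (fun w => \sum_l u l * V (h l) w).
Proof.
move=> h_inj.
suff H s : uniq s ->
    measurable_wrt (h @: [set l in s])%SET (fun w => \sum_(l <- s) u l * V (h l) w) /\
    subgaussian P (\sum_(l <- s) u l ^+ 2) (fun w => \sum_(l <- s) u l * V (h l) w).
  have [m1 s1] := H _ (index_enum_uniq L); split=> //.
  apply: sub_measurable_wrt m1; apply: imsetS; exact: finset.subsetT.
elim: s => [_|l s IHs /= /andP[ls us]].
  rewrite big_nil (_ : (fun w => \sum_(l <- [::]) _) = fun=> 0); last first.
    by apply/funext => w; rewrite big_nil.
  by split; [exact: measurable_cst|exact: subgaussian0].
have [ms ss] := IHs us.
have disj : [disjoint [set h l]%SET & (h @: [set l in s])%SET]%B.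
  by rewrite disjoints1; apply: contra ls => /imsetP[k]; rewrite inE => ks /h_inj ->.
rewrite big_cons (_ : (fun w => \sum_(k <- _) _) =
  fun w => u l * V (h l) w + \sum_(k <- s) u k * V (h k) w); last first.
  by apply/funext => w; rewrite big_cons.
split.
  have m1 : measurable_wrt (h @: [set k in l :: s])%SET (V (h l)).
    have : ([set h l] \subset h @: [set k in l :: s])%SET.
      by rewrite finset.sub1set; apply: imset_f; rewrite inE mem_head.
    by move=> /sub_measurable_wrt; apply; exact: mV.
  have m2 : measurable_wrt (h @: [set k in l :: s])%SET
      (fun w => \sum_(k <- s) u k * V (h k) w).
    apply: sub_measurable_wrt ms; apply: imsetS; apply/fintype.subsetP => k.
    by rewrite !inE => ->; rewrite orbT.
  by apply: measurable_funD => //; exact: measurable_funM.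
by rewrite -[u l ^+ 2]mulr1; apply: (subgaussianD _ disj).
Qed.

End SubgaussianRows.

Lemma lee_prod_nneg (R : realType) (I : finType) (f g : I -> \bar R) :
  (forall i, 0 <= f i)%E -> (forall i, f i <= g i)%E ->
  (\prod_i f i <= \prod_i g i)%E.
Proof.
move=> f0 fg; suff /andP[] : (0 <= \prod_i f i <= \prod_i g i)%E by [].
elim/big_ind2 : _ => [|x y x' y' /andP[x0 xy] /andP[x'0 xy']|i _].
- by rewrite lexx lee01.
- by rewrite mule_ge0//= lee_pmul.
- by rewrite f0 fg.
Qed.

(** * Chernoff bound for the squared norm of a projected unit vector, independent entries *)

Section ChiSquareTail.
Context {d : measure_display} {W : measurableType d} {R : realType}.
Variable P : probability W R.
Variables (k m : nat) (X : 'I_k * 'I_m -> {RV P >-> R}).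
Hypothesis indepX : mutually_independent X.
Variable a : R.
Hypothesis subX : forall i, subgaussian P 1 (fun w => a * X i w).
Variable u : 'I_m -> R.
Hypothesis u1 : \sum_j u j ^+ 2 = 1.

Let row i w := \sum_j u j * (a * X (i, j) w).

Let row_measurable i : measurable_fun setT (row i).
Proof. by apply: measurable_sum => j; do 2 apply: measurable_funM => //. Qed.

(** Distinct rows use disjoint index sets [J i], so the expectation splits into [k] factors, each
    bounded by [subgaussian_mgf_sqr]. *)
Lemma row_mgf (l : R) : `|l| <= 1 / 96 ->
  (\int[P]_w (expR (\sum_i l * (row i w ^+ 2 - 1)))%:E <=
   (expR (k%:R * (chi_const R * l ^+ 2)))%:E)%E.
Proof.
move=> l96.
pose J (i : 'I_k) := ((pair i : 'I_m -> 'I_k * 'I_m) @: [set: 'I_m])%SET.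
have row_sub i : measurable_wrt X (J i) (row i) /\ subgaussian P 1 (row i).
  rewrite -u1; apply: (subgaussian_sum indepX (V := fun ij w => a * X ij w)) => //.
    move=> ij; apply: measurable_funM => //.
    by apply: measurable_wrt_var; rewrite inE.
  by move=> j j' [].
under eq_integral do rewrite expR_sum.
rewrite (ge0_expectation_prod indepX (J := J)).
- apply: (@le_trans _ _ (\prod_(i < k) (expR (chi_const R * l ^+ 2))%:E)%E).
    apply: lee_prod_nneg => i; [by apply: integral_ge0 => w _; rewrite lee_fin expR_ge0|].
    by have [_ s1] := row_sub i; exact: subgaussian_mgf_sqr.
  by rewrite prodEFin lee_fin prodr_const card_ord -expRM_natl.
- move=> i i' ii'; rewrite -setI_eq0; apply/eqP/setP => -[x y]; rewrite !inE.
  apply/negP => /andP[/imsetP[j _ [-> _]] /imsetP[j' _ [/eqP]]].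
  by rewrite (negbTE ii').
- move=> i; have [m1 _] := row_sub i.
  apply: measurableT_comp => //; apply: measurable_funM => //.
  by apply: measurable_funB => //; exact: measurable_funX.
- by move=> i w; exact: expR_ge0.
Qed.

Lemma row_tail (sg eps : R) : `|sg| = 1 -> 0 < eps <= 1 ->
  (P [set w | (k%:R * eps <= \sum_i sg * (row i w ^+ 2 - 1))%R] <=
   (expR (- (eps ^+ 2 * k%:R / (4 * chi_const R))))%:E)%E.
Proof.
move=> sg1 /andP[e0 e1].
have C48 := @chi_const_ge48 R; have C0 : 0 < chi_const R by lra.
(* The minimizer of [chi_const * l ^+ 2 - l * eps], with minimum [- eps ^+ 2 / (4 * chi_const)]. The
   sign [sg] covers both tails. *)
pose l : R := eps / (2 * chi_const R).
have l0 : 0 < l by rewrite divr_gt0//; lra.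
have l96 : l <= 1 / 96 by rewrite ler_pdivrMr; lra.
have -> : [set w | (k%:R * eps <= \sum_i sg * (row i w ^+ 2 - 1))%R] =
    [set w | (l * (k%:R * eps) <= \sum_i (l * sg) * (row i w ^+ 2 - 1))%R].
  apply/seteqP; split=> w /=; rewrite (_ : \sum_i l * sg * _ =
    l * \sum_i sg * (row i w ^+ 2 - 1)) ?ler_pM2l// mulr_sumr;
  by apply: eq_bigr => i _; rewrite mulrA.
apply: le_trans (chernoff_bound _ _ (row_mgf _)) _.
- apply: measurable_sum => i; apply: measurable_funM => //.
  by apply: measurable_funB => //; exact: measurable_funX.
- by rewrite normrM sg1 mulr1 gtr0_norm.
rewrite lee_fin ler_expR exprMn -(real_normK (num_real sg)) sg1 expr1n mulr1.
rewrite le_eqVlt; apply/orP; left; apply/eqP; rewrite /l; field.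
by rewrite gt_eqF.
Qed.

End ChiSquareTail.

(** * Bounds on the hyperbolic cosine *)

Section HyperbolicIneqs.
Variable R : realType.
Implicit Types x y t : R.

Lemma expR_sub_le x : 0 <= x -> expR x - expR (- x) <= 2 * x * expR x.
Proof.
move=> x0; have h : expR (- x) = expR x * expR (- (2 * x)).
  by rewrite -expRD; congr expR; ring.
have h2 : 1 - 2 * x <= expR (- (2 * x)) by exact: expR_ge1Dx.
have := ler_wpM2l (expR_ge0 x) h2; rewrite -h; lra.
Qed.

Lemma expR_sub_ge x : 0 <= x -> 2 * x * expR (- x) <= expR x - expR (- x).
Proof.
move=> x0; have h : expR x = expR (- x) * expR (2 * x).
  by rewrite -expRD; congr expR; ring.
have h2 : 1 + 2 * x <= expR (2 * x) by exact: expR_ge1Dx.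
have := ler_wpM2l (expR_ge0 (- x)) h2; rewrite -h; lra.
Qed.

Lemma expR_addN_norm y : expR y + expR (- y) = expR `|y| + expR (- `|y|).
Proof.
have [y0|y0] := leP 0 y; first by rewrite ger0_norm.
by rewrite ltr0_norm// opprK addrC.
Qed.

Lemma expR_addN_sqr y :
  expR y + expR (- y) - 2 = (expR (`|y| / 2) - expR (- (`|y| / 2))) ^+ 2.
Proof.
rewrite expR_addN_norm sqrrB -expRM_natr -expRM_natr -expRD subrr expR0.
by rewrite mulNr !divfK//; lra.
Qed.

Lemma expR_addN_le y : expR y + expR (- y) - 2 <= y ^+ 2 * expR `|y|.
Proof.
have y0 : 0 <= `|y| / 2 by rewrite divr_ge0.
have h : 0 <= expR (`|y| / 2) - expR (- (`|y| / 2)).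
  by rewrite subr_ge0 ler_expR; lra.
rewrite expR_addN_sqr.
have : (expR (`|y| / 2) - expR (- (`|y| / 2))) ^+ 2 <=
    (2 * (`|y| / 2) * expR (`|y| / 2)) ^+ 2.
  by apply: lerXn2r (expR_sub_le y0); rewrite nnegrE// !mulr_ge0 ?expR_ge0.
move=> /le_trans; apply.
rewrite !exprMn -[expR _ ^+ 2]expRM_natr divfK// exprVn real_normK ?num_real//.
have := expR_ge0 `|y|; have := sqr_ge0 y; nra.
Qed.

Lemma expR_addN_ge y : y ^+ 2 * expR (- `|y|) <= expR y + expR (- y) - 2.
Proof.
have y0 : 0 <= `|y| / 2 by rewrite divr_ge0.
have h : 0 <= expR (`|y| / 2) - expR (- (`|y| / 2)).
  by rewrite subr_ge0 ler_expR; lra.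
rewrite expR_addN_sqr.
have : (2 * (`|y| / 2) * expR (- (`|y| / 2))) ^+ 2 <=
    (expR (`|y| / 2) - expR (- (`|y| / 2))) ^+ 2.
  by apply: lerXn2r (expR_sub_ge y0); rewrite nnegrE// !mulr_ge0 ?expR_ge0.
apply: le_trans.
rewrite !exprMn -[expR _ ^+ 2]expRM_natr mulNr divfK// exprVn real_normK ?num_real//.
have := expR_ge0 (- `|y|); have := sqr_ge0 y; nra.
Qed.

(** A third-order error suffices to recover a second moment: after the substitution [y = s X] and
    division by [s ^+ 2], a factor [s] remains. *)
Lemma expR_addN_sub_sqr y :
  `|expR y + expR (- y) - 2 - y ^+ 2| <= `|y| ^+ 3 * expR `|y|.
Proof.
have y0 := normr_ge0 y.
have h1 := expR_addN_le y; have h2 := expR_addN_ge y.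
rewrite -(real_normK (num_real y)) in h1 h2 *; set z := `|y| in y0 h1 h2 *.
have e1 : 1 - z <= expR (- z) by exact: expR_ge1Dx.
have e2 : 1 <= expR z by rewrite -[X in X <= _]expR0 ler_expR.
have e3 : expR z - 1 <= z * expR z.
  have : (1 - z) * expR z <= expR (- z) * expR z by rewrite ler_pM2r ?expR_gt0.
  rewrite -expRD addNr expR0; lra.
have z2 : 0 <= z ^+ 2 by exact: sqr_ge0.
have f1 := ler_wpM2l z2 e3; have f2 := ler_wpM2l z2 e1.
have f3 : z ^+ 3 <= z ^+ 3 * expR z by rewrite ler_peMr// exprn_ge0.
rewrite ler_norml; apply/andP; split; rewrite !exprS expr0 in f1 f2 f3 h1 h2 *; lra.
Qed.

(* The bound is clear for small [t], and [cosh (2 t) <= (cosh t) ^+ 4] carries it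
   from [t] to [2 t]. *)
Lemma cosh_le t : (expR t + expR (- t)) / 2 <= expR (2 / 3 * t ^+ 2).
Proof.
suff H n : forall t, `|t| <= 2 ^+ n / 4 ->
    (expR t + expR (- t)) / 2 <= expR (2 / 3 * t ^+ 2).
  apply: (H (Num.trunc (4 * `|t|)).+1); rewrite ler_pdivlMr// mulrC.
  have /andP[_ /ltW/le_trans] : ((Num.trunc (4 * `|t|))%:R <= 4 * `|t| <
      (Num.trunc (4 * `|t|)).+1%:R)%R by apply: truncn_itv; rewrite mulr_ge0.
  by apply; rewrite -natrX ler_nat ltnW// ltn_expl.
elim: n => [|n IHn] {}t tn.
  (* Here [|t| <= 1 / 4]. The bound [4 / 3], halved, is the constant [2 / 3] of the statement. *)
  have h : expR `|t| <= 4 / 3.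
    have h1 : 1 - `|t| <= expR (- `|t|) by exact: expR_ge1Dx.
    have h2 : expR `|t| * expR (- `|t|) = 1 by rewrite -expRD subrr expR0.
    have h3 : expR `|t| * (3 / 4) <= expR `|t| * expR (- `|t|).
      by rewrite ler_wpM2l ?expR_ge0//; rewrite expr0 in tn; lra.
    lra.
  apply: le_trans (expR_ge1Dx _).
  have := expR_addN_le t; have := ler_wpM2l (sqr_ge0 t) h; lra.
set c := (expR (t / 2) + expR (- (t / 2))) / 2.
have c0 : 0 <= c by rewrite divr_ge0// addr_ge0 ?expR_ge0.
have -> : (expR t + expR (- t)) / 2 = 2 * c ^+ 2 - 1.
  by rewrite /c expr_div_n sqrrD -!expRM_natr mulNr divfK// -expRD subrr expR0; lra.
have hc : c <= expR (2 / 3 * (t / 2) ^+ 2).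
  apply: IHn; rewrite normrM (ger0_norm (x := 2^-1))//.
  by rewrite exprS in tn; lra.
apply: (@le_trans _ _ (c ^+ 4)).
  have : 0 <= (c ^+ 2 - 1) ^+ 2 by exact: sqr_ge0.
  rewrite !exprS expr0; lra.
apply: (@le_trans _ _ (expR (2 / 3 * (t / 2) ^+ 2) ^+ 4)).
  by rewrite lerXn2r// nnegrE expR_ge0.
by rewrite -expRM_natr ler_expR le_eqVlt; apply/orP; left; apply/eqP; field.
Qed.

End HyperbolicIneqs.

(** * The three entry laws are sub-Gaussian *)

Section EntryDistributions.
Context {d : measure_display} {W : measurableType d} {R : realType}.
Variable P : probability W R.

(** The point masses add up to 1, so almost surely [X] takes a value in [s], where [f (X w)] is a
    finite combination of indicators. *)
Lemma integral_discrete (X : {RV P >-> R}) (s : seq R) (p f : R -> R) : uniq s ->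
  (forall x, x \in s -> P (X @^-1` [set x]) = (p x)%:E) ->
  \sum_(x <- s) p x = 1 -> measurable_fun setT f ->
  (\int[P]_w (f (X w))%:E = (\sum_(x <- s) f x * p x)%:E)%E.
Proof.
move=> us Pp p1 mf.
have mX x : measurable (X @^-1` [set x]).
  by rewrite -[_ @^-1` _]setTI; exact: measurable_funPT.
pose S (s' : seq R) := [set w | X w \in s'].
have SE x s' : S (x :: s') = (X @^-1` [set x]) `|` S s'.
  apply/seteqP; split=> w /=; rewrite /S /= inE.
    by case/orP=> [/eqP|]; [left|right].
  by case=> ->; rewrite ?eqxx ?orbT.
have mS s' : measurable (S s').
  elim: s' => [|x s' IH]; last by rewrite SE; exact: measurableU.
  by rewrite (_ : S [::] = set0)//; apply/seteqP; split.
have PS s' : uniq s' -> (P (S s') = \sum_(x <- s') P (X @^-1` [set x]))%E.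
  elim: s' => [_|x s' IH /= /andP[xs us']].
    by rewrite big_nil (_ : S [::] = set0) ?measure0//; apply/seteqP; split.
  rewrite big_cons SE -IH//; apply: measureU => //.
  apply/seteqP; split=> // w [/= Xx]; rewrite /S /= Xx => sx.
  by rewrite sx in xs.
have PS1 : P (~` S s) = 0%E.
  rewrite probability_setC// PS// big_seq; under eq_bigr do rewrite Pp//.
  by rewrite -big_seq sumEFin p1 subee.
pose g w := \sum_(x <- s) f x * \1_(X @^-1` [set x]) w.
have gX w : S s w -> f (X w) = g w.
  move=> Sw; rewrite /g (bigD1_seq (X w))//= big1 ?addr0 => [|x xX].
    by rewrite indicE mem_set// mulr1.
  by rewrite indicE memNset ?mulr0// => /= Xx; rewrite Xx eqxx in xX.
have gi s' : P.-integrable setT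
    (EFin \o (fun w => \sum_(x <- s') f x * \1_(X @^-1` [set x]) w)) /\
    (\int[P]_w (\sum_(x <- s') f x * \1_(X @^-1` [set x]) w)%:E =
     \sum_(x <- s') (f x)%:E * P (X @^-1` [set x]))%E.
  elim: s' => [|x s' [IH1 IH2]].
    rewrite big_nil (_ : (fun w => \sum_(x <- [::]) _) = cst 0); last first.
      by apply/funext => w; rewrite big_nil.
    split; first exact: finite_measure_integrable_cst.
    by apply: integral0_eq => w _; rewrite big_nil.
  rewrite (_ : (fun w => \sum_(y <- _) _) = fun w => f x * \1_(X @^-1` [set x]) w +
      \sum_(y <- s') f y * \1_(X @^-1` [set y]) w); last first.
    by apply/funext => w; rewrite big_cons.
  have i1 : P.-integrable setT (EFin \o \1_(X @^-1` [set x])).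
    exact: integrable_indic.
  split; first exact: integrable_addr (integrable_scaler _ i1) IH1.
  rewrite big_cons -IH2; under eq_integral do rewrite big_cons.
  rewrite (integral_addr (integrable_scaler _ i1) IH1) integral_scaler//.
  by rewrite integral_indic// setIT.
have [i1 i2] := gi s.
transitivity (\int[P]_w (g w)%:E)%E; last first.
  rewrite i2 -sumEFin big_seq [RHS]big_seq; apply: eq_bigr => x xs.
  by rewrite Pp.
apply: ae_eq_integral => //.
- by apply/measurable_EFinP; exact: measurableT_comp.
- exact: measurable_int i1.
exists (~` S s); split => //; first exact: measurableC.
by move=> w /= /not_implyP[_ fg] Sw; apply: fg; rewrite gX.
Qed.

Lemma rademacher_subgaussian (X : {RV P >-> R}) : rademacher X ->
  subgaussian P 1 (fun w => 1 * X w).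
Proof.
move=> [P1 PN1].
pose p (x : R) : R := 1 / 2.
have n11 : (1 == -1 :> R) = false by apply/eqP; lra.
have E f : measurable_fun setT f ->
    (\int[P]_w (f (X w))%:E = (f 1 * (1 / 2) + f (-1) * (1 / 2))%:E)%E.
  move=> mf; rewrite (integral_discrete (s := [:: 1; -1]) (p := p))//.
  - by rewrite !big_cons big_nil addr0.
  - by rewrite /= inE n11.
  - by move=> x; rewrite !inE => /orP[]/eqP->.
  - by rewrite !big_cons big_nil /p; lra.
split.
- exact: measurable_funM.
- move=> s; rewrite (E (fun x => expR (s * (1 * x)))); last first.
    by apply: measurableT_comp => //; apply: measurable_funM => //; exact: measurable_funM.
  rewrite lee_fin !mul1r !mulr1 mulrN1 -mulrDl.
  apply: le_trans (cosh_le s) _; rewrite ler_expR; have := sqr_ge0 s; lra.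
- rewrite (E (fun x => (1 * x) ^+ 2)).
    by congr EFin; rewrite !mul1r sqrrN !expr1n; lra.
  by apply: measurable_funX; exact: measurable_funM.
- by rewrite (E (fun x => 1 * x))//; [congr EFin; lra|exact: measurable_funM].
Qed.

(** The Laplace transform is [(cosh (sqrt 3 * s) + 2) / 3]. By [cosh_le] the cosine is at most
    [exp (2 / 3 * 3 s ^+ 2)], which is exactly the allowed [exp (2 s ^+ 2)], and the constant part
    is below it too. *)
Lemma sparse_sign_subgaussian (X : {RV P >-> R}) : sparse_sign X ->
  subgaussian P 1 (fun w => Num.sqrt 3 * X w).
Proof.
move=> [P1 P0 PN1].
pose p (x : R) : R := if x == 0 then 2 / 3 else 1 / 6.
have n11 : (1 == -1 :> R) = false by apply/eqP; lra.
have n01 : (0 == -1 :> R) = false by apply/eqP; lra.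
have pN1 : (-1 == 0 :> R) = false by rewrite eq_sym.
have E f : measurable_fun setT f ->
    (\int[P]_w (f (X w))%:E = (f 1 * (1 / 6) + f 0 * (2 / 3) + f (-1) * (1 / 6))%:E)%E.
  move=> mf; rewrite (integral_discrete (s := [:: 1; 0; -1]) (p := p))//.
  - by rewrite !big_cons big_nil addr0 addrA /p eqxx oner_eq0 pN1.
  - by rewrite /= !inE n11 n01 oner_eq0.
  - by move=> x; rewrite !inE => /or3P[]/eqP->; rewrite /p ?eqxx ?oner_eq0 ?pN1.
  - by rewrite !big_cons big_nil /p eqxx oner_eq0 pN1; lra.
have s3 : Num.sqrt 3 ^+ 2 = 3 :> R by rewrite sqr_sqrtr//; lra.
split.
- exact: measurable_funM.
- move=> s; rewrite (E (fun x => expR (s * (Num.sqrt 3 * x)))); last first.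
    by apply: measurableT_comp => //; apply: measurable_funM => //; exact: measurable_funM.
  rewrite lee_fin !mulr0 expR0 !mulr1 mulrN1 mulrN.
  have := cosh_le (s * Num.sqrt 3); rewrite exprMn s3 => h.
  have -> : 2 * s ^+ 2 = 2 / 3 * (s ^+ 2 * 3) by field.
  have : 1 <= expR (2 / 3 * (s ^+ 2 * 3)).
    by rewrite -[X in X <= _]expR0 ler_expR; have := sqr_ge0 s; lra.
  lra.
- rewrite (E (fun x => (Num.sqrt 3 * x) ^+ 2)).
    by congr EFin; rewrite !exprMn s3 sqrrN expr1n expr0n/=; lra.
  by apply: measurable_funX; exact: measurable_funM.
- by rewrite (E (fun x => Num.sqrt 3 * x))//; [congr EFin; lra|exact: measurable_funM].
Qed.

(* The first two moments are read off the expansion of the moment generating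
   function at [0]. *)
Lemma gaussian_mgf_subgaussian (X : W -> R) : measurable_fun setT X ->
  (forall s, (\int[P]_w (expR (s * X w))%:E = (expR (s ^+ 2 / 2))%:E)%E) ->
  subgaussian P 1 X.
Proof.
move=> mX mgf.
have ie s : P.-integrable setT (EFin \o (fun w => expR (s * X w))).
  apply: ge0_integrable.
  - by apply: measurableT_comp => //; exact: measurable_funM.
  - by move=> w; exact: expR_ge0.
  - by rewrite mgf ltry.
have expN t : expR (2 * `|t|) <= expR (2 * t) + expR (- 2 * t) :> R.
  have [t0|t0] := leP 0 t; first by rewrite ger0_norm// lerDl expR_ge0.
  by rewrite ltr0_norm// mulrN mulNr lerDr expR_ge0.
have cube t : `|t| ^+ 3 <= 27 * expR `|t| :> R.
  have h : `|t| / 3 <= expR (`|t| / 3) by apply: le_trans (expR_ge1Dx _); lra.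
  have : (`|t| / 3) ^+ 3 <= expR (`|t| / 3) ^+ 3.
    by rewrite lerXn2r// nnegrE ?expR_ge0// divr_ge0.
  rewrite -expRM_natr divfK// expr_div_n; lra.
pose h w := `|X w| ^+ 3 * expR `|X w|.
have mh : measurable_fun setT h.
  apply: measurable_funM; first by apply: measurable_funX; exact: measurableT_comp.
  by apply: measurableT_comp => //; exact: measurableT_comp.
have h0 w : 0 <= h w by rewrite mulr_ge0 ?expR_ge0// exprn_ge0.
have ih : P.-integrable setT (EFin \o h).
  apply: (integrable_dominated mh _
    (integrable_scaler 27 (integrable_addr (ie 2) (ie (-2))))) => w.
  rewrite ger0_norm// (le_trans _ (ler_wpM2l _ (expN (X w))))//.
  rewrite mulr_natl mulr2n expRD mulrA ler_wpM2r ?expR_ge0//.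
have iX2 : P.-integrable setT (EFin \o (fun w => X w ^+ 2)).
  apply: (@integrable_dominated _ _ _ P _ (fun w => expR (1 * X w) + expR (-1 * X w) + h w)).
  - exact: measurable_funX.
  - move=> w; rewrite mul1r mulN1r ger0_norm ?sqr_ge0//.
    have := expR_addN_sub_sqr (X w); rewrite ler_norml => /andP[] _.
    have := expR_addN_sub_sqr (X w); rewrite ler_norml => /andP[].
    rewrite -/(h w); lra.
  - exact/integrable_addr/ih/integrable_addr/ie/ie.
have iX : P.-integrable setT (EFin \o X).
  apply: (integrable_dominated mX _ (integrable_addr iX2
    (finite_measure_integrable_cst P 1 measurableT))) => w /=.
  have := sqr_ge0 (`|X w| - 1).
  rewrite sqrrB real_normK ?num_real// expr1n mulr1.
  have := sqr_ge0 (X w); lra.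
have small s : 0 <= s <= 1 -> expR (s ^+ 2 / 2) <= 1 + s ^+ 2 / 2 + s ^+ 3 / 2 :> R.
  move=> /andP[s0 s1].
  have s2 : s ^+ 2 <= 1 by rewrite expr_le1.
  have h1 : 1 - s ^+ 2 / 2 <= expR (- (s ^+ 2 / 2)) by exact: expR_ge1Dx.
  have h2 : expR (s ^+ 2 / 2) * expR (- (s ^+ 2 / 2)) = 1 by rewrite -expRD subrr expR0.
  have h3 := ler_wpM2l (expR_ge0 (s ^+ 2 / 2)) h1.
  have e2 : expR (s ^+ 2 / 2) <= 2 by nra.
  have h5 : s ^+ 4 <= s ^+ 3 by rewrite exprS ler_piMl// exprn_ge0.
  have s20 := sqr_ge0 s.
  have h4 : expR (s ^+ 2 / 2) * (s ^+ 2 / 2) <= (1 + s ^+ 2) * (s ^+ 2 / 2).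
    by rewrite ler_wpM2r//; nra.
  rewrite h2 in h3; lra.
split=> //.
- by move=> s; rewrite mgf lee_fin ler_expR; have := sqr_ge0 s; lra.
- have hfin : (\int[P]_w (h w)%:E)%E \is a fin_num by exact: integral_fune_fin_num ih.
  have X2fin : (\int[P]_w (X w ^+ 2)%:E)%E \is a fin_num.
    exact: integral_fune_fin_num iX2.
  rewrite -(fineK X2fin); set e := fine _; set K := fine (\int[P]_w (h w)%:E)%E.
  have K0 : 0 <= K by rewrite fine_ge0// integral_ge0// => w _; rewrite lee_fin.
  (* The expectation of [2 cosh (s X) - 2 - s ^+ 2 X ^+ 2], known from the moment generating
     function, is at most [s ^+ 3 K] in absolute value by [expR_addN_sub_sqr]. *)
  have key s : 0 < s <= 1 ->
      `|2 * (expR (s ^+ 2 / 2) - 1) - s ^+ 2 * e| <= s ^+ 3 * K.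
    move=> /andP[s0 s1].
    pose q w := expR (s * X w) + (expR (- s * X w) + (- 2 + (- s ^+ 2) * X w ^+ 2)).
    have ic : P.-integrable setT (EFin \o (fun=> - 2 : R)).
      exact: finite_measure_integrable_cst.
    have i1 := integrable_addr ic (integrable_scaler (- s ^+ 2) iX2).
    have i2 := integrable_addr (ie (- s)) i1.
    have iq := integrable_addr (ie s) i2.
    have qE : (\int[P]_w (q w)%:E =
        (2 * (expR (s ^+ 2 / 2) - 1) - s ^+ 2 * e)%:E)%E.
      rewrite (integral_addr (ie s) i2) (integral_addr (ie (- s)) i1).
      rewrite (integral_addr ic (integrable_scaler _ iX2)) integral_scaler//.
      rewrite !mgf -(fineK X2fin) -/e integral_cst//= probability_setT mule1.
      by rewrite -EFinM -!EFinD sqrrN; congr EFin; ring.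
    have qh w : `|q w| <= s ^+ 3 * h w.
      have := expR_addN_sub_sqr (s * X w); rewrite -mulNr.
      rewrite (_ : _ - 2 - _ = q w); last by rewrite /q; ring.
      move=> /le_trans; apply.
      rewrite /h normrM (gtr0_norm s0) exprMn -mulrA ler_wpM2l ?exprn_ge0 ?(ltW s0)//.
      by rewrite ler_wpM2l ?exprn_ge0// ler_expR ler_piMl.
    have qle : (\int[P]_w (q w)%:E <= \int[P]_w (s ^+ 3 * h w)%:E)%E.
      apply: le_integral => //; first exact: integrable_scaler.
      by move=> w _; rewrite lee_fin (le_trans (ler_norm _)).
    have qge : (\int[P]_w (- s ^+ 3 * h w)%:E <= \int[P]_w (q w)%:E)%E.
      apply: le_integral => //; first exact: integrable_scaler.
      by move=> w _; rewrite lee_fin mulNr lerNl (le_trans (ler_norm _))// normrN.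
    rewrite !integral_scaler// qE -(fineK hfin) -/K -!EFinM !lee_fin in qle qge.
    by rewrite ler_norml qle andbT -mulNr.
  (* Division by [s ^+ 2]; letting [s] tend to 0 forces [e = 1]. *)
  have e1 s : 0 < s <= 1 -> `|1 - e| <= s * (K + 1).
    move=> s01; have /andP[s0 s1] := s01.
    have := key _ s01; have := small s; rewrite (ltW s0) s1 => /(_ isT) sm.
    have lo : 1 + s ^+ 2 / 2 <= expR (s ^+ 2 / 2) by exact: expR_ge1Dx.
    have s2 : 0 < s ^+ 2 by rewrite exprn_gt0.
    rewrite ler_norml => /andP[k1 k2].
    rewrite -(ler_pM2l s2) -[X in X * `|_|](gtr0_norm s2) -normrM.
    rewrite (_ : s ^+ 2 * (s * (K + 1)) = s ^+ 3 * K + s ^+ 3); last by ring.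
    rewrite ler_norml; apply/andP; split; lra.
  congr EFin; apply/eqP; rewrite eq_sym -subr_eq0 -normr_eq0 eq_le normr_ge0 andbT.
  apply/ler_addgt0Pr => z z0; rewrite add0r.
  pose s := Num.min 1 (z / (K + 1)).
  have K1 : 0 < K + 1 by lra.
  have s01 : 0 < s <= 1 by rewrite lt_min ltr01 divr_gt0//= ge_min lexx.
  apply: le_trans (e1 _ s01) _.
  by rewrite -ler_pdivlMr// ge_min lexx orbT.
- have Xfin : (\int[P]_w (X w)%:E)%E \is a fin_num by exact: integral_fune_fin_num iX.
  rewrite -(fineK Xfin); set e := fine _.
  (* Integrating the tangent inequality. Small [s] of both signs then pin the mean to 0. *)
  have key s : 1 + s * e <= expR (s ^+ 2 / 2).
    have ic : P.-integrable setT (EFin \o (fun=> 1 : R)).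
      exact: finite_measure_integrable_cst.
    have isX := integrable_scaler s iX.
    have : (\int[P]_w (1 + s * X w)%:E <= \int[P]_w (expR (s * X w))%:E)%E.
      apply: le_integral => //; [exact: integrable_addr ic isX|exact: ie|].
      by move=> w _; rewrite lee_fin expR_ge1Dx.
    rewrite mgf (integral_addr ic isX) integral_scaler// -(fineK Xfin) -/e.
    by rewrite integral_cst//= probability_setT mule1 -EFinM -EFinD lee_fin.
  have e0 s : 0 < s <= 1 -> `|e| <= s.
    move=> /andP[s0 s1]; have := small s; rewrite (ltW s0) s1 => /(_ isT) sm.
    have s3 : s ^+ 3 <= s ^+ 2.
      by rewrite exprS ler_piMl// sqr_ge0.
    have := key s; have := key (- s); rewrite sqrrN => k1 k2.
    rewrite -(ler_pM2l s0) -[X in X * `|_|](gtr0_norm s0) -normrM -expr2.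
    by rewrite ler_norml; apply/andP; split; lra.
  congr EFin; apply/eqP; rewrite -normr_eq0 eq_le normr_ge0 andbT.
  apply/ler_addgt0Pr => z z0; rewrite add0r.
  have s01 : 0 < Num.min 1 z <= 1 by rewrite lt_min ltr01 z0/= ge_min lexx.
  by apply: le_trans (e0 _ s01) _; rewrite ge_min lexx orbT.
Qed.

Import HBNNSimple.

(** Proved for simple functions level set by level set, then by monotone convergence along
    [nnsfun_approx]. *)
Lemma ge0_integral_density d' (T : measurableType d')
    (mu nu : {measure set T -> \bar R}) (g : T -> R) (f : T -> \bar R) :
  measurable_fun setT g -> (forall x, 0 <= g x) ->
  (forall A, measurable A -> nu A = \int[mu]_(x in A) (g x)%:E)%E ->
  measurable_fun setT f -> (forall x, 0 <= f x)%E ->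
  (\int[nu]_x f x = \int[mu]_x (f x * (g x)%:E))%E.
Proof.
move=> mg g0 nuE mf f0.
have simple (h : {nnsfun T >-> R}) :
    (\int[nu]_x (h x)%:E = \int[mu]_x ((h x)%:E * (g x)%:E))%E.
  under [LHS]eq_integral do rewrite fimfunE -fsumEFin//.
  rewrite [LHS]ge0_integral_fsum//; last 2 first.
  - by move=> r; exact/measurable_EFinP/measurableT_comp.
  - by move=> n x _; rewrite EFinM nnfun_muleindic_ge0.
  under [RHS]eq_integral.
    move=> x xD; rewrite fimfunE -fsumEFin// ge0_mule_fsuml; last first.
      by move=> r; rewrite EFinM nnfun_muleindic_ge0.
    over.
  rewrite [RHS]ge0_integral_fsum//; last 2 first.
  - move=> r; apply/emeasurable_funM; last exact/measurable_EFinP.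
    exact/measurable_EFinP/measurableT_comp.
  - move=> n x _; apply: mule_ge0; last by rewrite lee_fin.
    by rewrite EFinM nnfun_muleindic_ge0.
  apply: eq_fsbigr => r _.
  rewrite integralZl_indic_nnsfun//= integral_indic// setIT nuE//.
  (* A negative level has an empty preimage; it is treated apart because taking the scalar out of
     the integral asks for a nonnegative one. *)
  have [r0|r0] := ltP r 0.
    rewrite (_ : h @^-1` [set r] = set0).
      rewrite integral_set0 mule0 integral0_eq// => x _.
      by rewrite indic0 mulr0 mul0e.
    by apply/seteqP; split=> // x /= hx; have : 0 <= h x by []; rewrite hx leNgt r0.
  rewrite integral_mkcond -ge0_integralZl//.
  - apply: eq_integral => x _; rewrite patchE indicE.
    by case: ifPn => _; rewrite ?mulr1 ?mulr0 ?mul0e ?mule0// EFinM.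
  - apply/(measurable_restrictT _ _).1 => //.
    by apply/measurable_EFinP; exact: measurable_funTS.
  - by move=> x _; rewrite patchE; case: ifPn => // _; rewrite lee_fin.
pose f_ := nnsfun_approx measurableT mf.
transitivity (lim (\int[nu]_x (f_ n x)%:E @[n --> \oo])%E).
  rewrite -monotone_convergence//=.
  - apply: eq_integral => ? /[!inE] xD; apply/esym/cvg_lim => //=.
    exact: cvg_nnsfun_approx.
  - by move=> n; exact/measurable_EFinP/measurable_funTS.
  - by move=> n ? _; rewrite lee_fin.
  - by move=> ? _ ? ? mn; rewrite lee_fin; exact/lefP/nd_nnsfun_approx.
under eq_fun do rewrite simple.
rewrite -monotone_convergence//=.
- apply: eq_integral => x _; apply/cvg_lim => //.
  by apply: cvgeZr => //; exact: cvg_nnsfun_approx.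
- by move=> n; apply: emeasurable_funM; exact/measurable_EFinP.
- by move=> n x _; rewrite mule_ge0// lee_fin.
- move=> x _ n n' nn'; rewrite lee_wpmul2r ?lee_fin//.
  exact/lefP/nd_nnsfun_approx.
Qed.

(** Completing the square: [expR (s * x)] times the standard density is [expR (s ^+ 2 / 2)] times
    the density centred at [s]. *)
Lemma normal_mgf (s : R) :
  (\int[normal_prob 0 1]_x (expR (s * x))%:E = (expR (s ^+ 2 / 2))%:E)%E.
Proof.
have mE : measurable_fun [set: R] (fun x => expR (s * x)).
  by apply: measurableT_comp => //; exact: measurable_funM.
rewrite (ge0_integral_density (mu := lebesgue_measure) (g := normal_pdf 0 1))//; last 3 first.
- exact: measurable_normal_pdf.
- by move=> x; exact: normal_pdf_ge0.
- exact/measurable_EFinP.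
have pdfE (x : R) :
    expR (s * x) * normal_pdf 0 1 x = expR (s ^+ 2 / 2) * normal_pdf s 1 x.
  rewrite !normal_pdfE ?oner_neq0// /normal_fun mulrCA [RHS]mulrCA; congr (_ * _).
  by rewrite -!expRD; congr expR; rewrite expr1n; field.
under eq_integral do rewrite -EFinM pdfE EFinM.
rewrite ge0_integralZl//.
- by rewrite integral_normal_pdf mule1.
- by apply/measurable_EFinP; exact: measurable_normal_pdf.
- by move=> x _; rewrite lee_fin normal_pdf_ge0.
Qed.

Lemma standard_normal_subgaussian (X : {RV P >-> R}) : standard_normal X ->
  subgaussian P 1 (fun w => 1 * X w).
Proof.
move=> NX; apply: gaussian_mgf_subgaussian; first exact: measurable_funM.
move=> s; under eq_integral do rewrite mul1r.
have mX : measurable_fun setT (X : W -> measurableTypeR R) by exact: (measurable_funPT X).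
pose Y : {mfun W >-> measurableTypeR R} :=
  HB.pack (X : W -> measurableTypeR R) (@isMeasurableFun.Build _ _ _ _ _ mX).
have mE : measurable_fun [set: measurableTypeR R] (fun x => (expR (s * x))%:E).
  apply/measurable_EFinP.
  by apply: measurableT_comp => //; exact: measurable_funM.
rewrite -normal_mgf -[LHS](ge0_integral_distribution Y mE); last first.
  by move=> x; rewrite lee_fin expR_ge0.
by apply: eq_measure_integral => A mA _; exact: NX.
Qed.

End EntryDistributions.

(** * Differentiation, plane rotations and derivatives under the integral sign *)

Section Calculus.
Variable R : realType.

Lemma nonincreasing_of_derive (f df : R -> R) (b : R) : 0 <= b ->
  (forall x : R, is_derive x 1 f (df x)) -> (forall x, 0 <= x <= b -> df x <= 0) ->
  f b <= f 0.
Proof.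
move=> b0 fd df0.
have [c + cE] : exists2 c, c \in `[0, b]%R & f b - f 0 = df c * (b - 0).
  apply: MVT_segment => //; apply: derivable_within_continuous => x _; exact: ex_derive.
rewrite in_itv/= => /df0 dfc; rewrite -subr_le0 cE subr0.
exact: mulr_le0_ge0.
Qed.

Lemma is_derive_expR_comp (f : R -> R) (x df : R) :
  is_derive x 1 f df -> is_derive x 1 (fun t => expR (f t)) (expR (f x) * df).
Proof. by move=> fd; apply: is_derive1_comp; exact: is_derive_expR. Qed.

Lemma is_derive_mul (f g : R -> R) (x df dg : R) :
  is_derive x 1 f df -> is_derive x 1 g dg ->
  is_derive x 1 (fun t => f t * g t) (df * g x + f x * dg).
Proof.
move=> fd gd; apply: is_derive_eq (is_deriveM fd gd) _.
by rewrite addrC [_ *: df]mulrC.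
Qed.

Lemma is_derive_mulr (f : R -> R) (x df k : R) :
  is_derive x 1 f df -> is_derive x 1 (fun t => f t * k) (df * k).
Proof.
move=> fd; apply: is_derive_eq (is_derive_mul fd (is_derive_cst k x 1)) _.
by rewrite mulr0 addr0.
Qed.

(* Entries [0,0] and [0,l] of a symmetric matrix with entries [x], [y], [z] at
   [0,0], [0,l], [l,l], after a rotation of angle [t] in the plane [(0,l)]. *)
Definition rot_diag (x y z t : R) : R :=
  cos t * cos t * x + cos t * sin t * (2 * y) + sin t * sin t * z.
Definition rot_offdiag (x y z t : R) : R :=
  cos t * cos t * y + sin t * sin t * (- y) + cos t * sin t * (z - x).

Lemma is_derive_rot_diag (x y z t : R) :
  is_derive t 1 (rot_diag x y z) (2 * rot_offdiag x y z t).
Proof.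
apply: is_derive_eq; rewrite /GRing.scale /= /rot_offdiag; ring.
Qed.

Definition rot_offdiag' (x y z t : R) : R :=
  - (4 * (cos t * sin t) * y) + (cos t * cos t - sin t * sin t) * (z - x).

Lemma is_derive_rot_offdiag (x y z t : R) :
  is_derive t 1 (rot_offdiag x y z) (rot_offdiag' x y z t).
Proof.
apply: is_derive_eq; rewrite /GRing.scale /= /rot_offdiag'; ring.
Qed.

(** Bounds uniform in the angle, which serve as dominating constants when an expectation is
    differentiated in [t]. *)
Lemma rot_bounds x y z t : `|x| <= 1 -> `|y| <= 1 -> `|z| <= 1 ->
  [/\ `|rot_diag x y z t| <= 4, `|rot_offdiag x y z t| <= 4 &
      `|rot_offdiag' x y z t| <= 8].
Proof.
move=> x1 y1 z1.
have c1 : `|cos t| <= 1 by rewrite ler_norml cos_geN1 cos_le1.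
have s1 : `|sin t| <= 1 by rewrite ler_norml sin_geN1 sin_le1.
have M (a b : R) : `|a| <= 1 -> `|b| <= 1 -> `|a * b| <= 1.
  by move=> a1 b1; rewrite normrM mulr_ile1.
have cc := M _ _ c1 c1; have cs := M _ _ c1 s1; have ss := M _ _ s1 s1.
have := (M _ _ cc x1, M _ _ cc y1, M _ _ cc z1).
have := (M _ _ cs x1, M _ _ cs y1, M _ _ cs z1).
have := (M _ _ ss x1, M _ _ ss y1, M _ _ ss z1).
rewrite /rot_diag /rot_offdiag /rot_offdiag' !ler_norml.
move=> [[/andP[? ?] /andP[? ?]] /andP[? ?]].
move=> [[/andP[? ?] /andP[? ?]] /andP[? ?]].
move=> [[/andP[? ?] /andP[? ?]] /andP[? ?]].
by split; apply/andP; split; lra.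
Qed.

Context {d : measure_display} {W : measurableType d}.
Variable P : probability W R.

Lemma bounded_integrable (f : W -> R) (M : R) : measurable_fun setT f ->
  (forall w, `|f w| <= M) -> P.-integrable setT (EFin \o f).
Proof.
move=> mf fM; apply: (integrable_dominated mf fM).
exact: finite_measure_integrable_cst.
Qed.

(** The bounds are required only within distance 1 of [a]: an integrand such as [expR (t * x)] is
    not bounded uniformly in all [t]. *)
Lemma is_derive_Rintegral (f f' : R -> W -> R) (a B M : R) :
  (forall (t : R) w, is_derive t 1 (f ^~ w) (f' t w)) ->
  (forall t, measurable_fun setT (f t)) ->
  (forall t w, `|t - a| < 1 -> `|f t w| <= B) ->
  (forall t w, `|t - a| < 1 -> `|f' t w| <= M) ->
  is_derive a 1 (fun t => \int[P]_w f t w) (\int[P]_w f' a w).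
Proof.
move=> fd mf fB f'M.
have I_near x : (`]a - 1, a + 1[%classic : set R) x -> `|x - a| < 1.
  rewrite /= in_itv/= => /andP[ax xa]; rewrite ltr_norml; lra.
have Ia : (`]a - 1, a + 1[%classic : set R) a by rewrite /= in_itv/=; apply/andP; split; lra.
have d1E x y : partial1of2 f x y = f' x y.
  by rewrite partial1of2E; apply: derive_val.
have intf x : (`]a - 1, a + 1[%classic : set R) x -> P.-integrable setT (EFin \o f x).
  by move=> /I_near xa; apply: (@bounded_integrable _ B) => // w; exact: fB.
have derf x y : (`]a - 1, a + 1[%classic : set R) x -> setT y -> derivable (f ^~ y) x 1.
  by move=> _ _; exact: ex_derive.
have G_ub x y : (`]a - 1, a + 1[%classic : set R) x -> setT y -> `|partial1of2 f x y| <= Num.max 0 M.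
  by move=> /I_near xa _; rewrite d1E le_max f'M ?orbT.
have G0 (y : W) : 0 <= Num.max 0 M by rewrite le_max lexx.
have iG : P.-integrable setT (EFin \o (fun=> Num.max 0 M)).
  exact: finite_measure_integrable_cst.
apply: DeriveDef.
  exact: (derivable_under_integral measurableT Ia intf derf G0 iG G_ub).
rewrite -derive1E (differentiation_under_integral measurableT Ia intf derf G0 iG G_ub).
by apply: eq_Rintegral => w _; rewrite d1E.
Qed.

End Calculus.

(** * Reflections and their action on matrix entries *)

Section Householder.
Variables (R : realType) (m : nat).
Implicit Types (a u v : 'cV[R]_m) (M : 'M[R]_m).

Definition householder a : 'M[R]_m := 1%:M - 2 *: (a *m a^T).

Lemma tr_householder a : (householder a)^T = householder a.
Proof. by rewrite /householder linearB linearZ /= trmx1 trmx_mul trmxK. Qed.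

Lemma householderE a u : householder a *m u = u - (2 * dotv a u) *: a.
Proof.
rewrite mulmxBl mul1mx -scalemxAl -mulmxA [a^T *m u]mx11_scalar mul_mx_scalar.
by rewrite scalerA.
Qed.

Lemma householder_orthogonal a : dotv a a = 1 ->
  householder a *m (householder a)^T = 1%:M.
Proof.
move=> a1; rewrite tr_householder {1}/householder mulmxBl mul1mx -scalemxAl.
have aH : a^T *m householder a = - a^T.
  rewrite -[LHS]trmxK trmx_mul tr_householder trmxK householderE a1 mulr1.
  by rewrite scaler_nat mulr2n opprD addrA subrr sub0r linearN.
rewrite -mulmxA aH mulmxN scalerN opprK /householder subrK//.
Qed.

Lemma conj_entry (O M : 'M[R]_m) i j :
  (O *m M *m O^T) i j =
  dotv (O^T *m delta_mx i 0) (M *m (O^T *m delta_mx j 0)).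
Proof.
rewrite /dotv trmx_mul trmxK trmx_delta !mulmxA -!(mulmxA (delta_mx 0 i)).
by rewrite -colE -rowE !mxE.
Qed.

Lemma dotv_delta M i j : dotv (delta_mx i 0) (M *m delta_mx j 0) = M i j.
Proof.
have := conj_entry 1%:M M i j.
by rewrite trmx1 !mul1mx mulmx1.
Qed.

Lemma dotv_delta2 i j : dotv (delta_mx i 0) (delta_mx j 0 : 'cV[R]_m) = (i == j)%:R.
Proof. by have := dotv_delta 1%:M i j; rewrite mul1mx => ->; rewrite mxE. Qed.

(* On the entries [i,i] and [i,l], the reflection acts up to sign as the rotation of
   angle [t], and its orthogonality is immediate. *)
Lemma reflection_entries M i l t : i != l -> M^T = M ->
  let a := cos (t / 2) *: delta_mx i 0 + sin (t / 2) *: delta_mx l 0 in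
  [/\ dotv a a = 1,
      (householder a *m M *m (householder a)^T) i i =
        rot_diag (M i i) (M i l) (M l l) t &
      (householder a *m M *m (householder a)^T) i l =
        - rot_offdiag (M i i) (M i l) (M l l) t].
Proof.
move=> il MT a.
have li : (l == i) = false by rewrite eq_sym (negbTE il).
have cE : cos t = cos (t / 2) ^+ 2 - sin (t / 2) ^+ 2.
  by rewrite [in LHS](splitr t) cosD !expr2.
have sE : sin t = 2 * cos (t / 2) * sin (t / 2).
  by rewrite [in LHS](splitr t) sinD; ring.
have cs1 := cos2Dsin2 (t / 2).
have ai : dotv a (delta_mx i 0) = cos (t / 2).
  by rewrite dotvDl !dotvZl !dotv_delta2 eqxx li mulr1 mulr0 addr0.
have al : dotv a (delta_mx l 0) = sin (t / 2).
  by rewrite dotvDl !dotvZl !dotv_delta2 eqxx (negbTE il) mulr1 mulr0 add0r.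
have Hi : householder a *m delta_mx i 0 =
    - (cos t *: delta_mx i 0 + sin t *: delta_mx l 0) :> 'cV[R]_m.
  rewrite householderE ai cE sE /a (_ : sin (t / 2) ^+ 2 = 1 - cos (t / 2) ^+ 2); last by lra.
  apply/matrixP => p q; rewrite !mxE; ring.
have Hl : householder a *m delta_mx l 0 =
    - sin t *: delta_mx i 0 + cos t *: delta_mx l 0 :> 'cV[R]_m.
  rewrite householderE al cE sE /a (_ : cos (t / 2) ^+ 2 = 1 - sin (t / 2) ^+ 2); last by lra.
  apply/matrixP => p q; rewrite !mxE; ring.
have Mli : M l i = M i l by rewrite -{1}MT mxE.
split.
- by rewrite {1}/a dotvDl !dotvZl !(dotvC _ a) ai al -!expr2.
- rewrite conj_entry tr_householder Hi mulmxN dotvNl dotvC dotvNl opprK.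
  rewrite mulmxDr -!scalemxAr dotvDl !dotvZl !dotvDr !dotvZr.
  rewrite -!(dotvC (delta_mx _ _)) !dotv_delta Mli /rot_diag; ring.
- rewrite conj_entry tr_householder Hi Hl dotvNl.
  rewrite mulmxDr -!scalemxAr dotvDl !dotvZl !dotvDr !dotvZr.
  rewrite !dotv_delta Mli /rot_offdiag; ring.
Qed.

End Householder.

(** * Integrals of sums, equality of laws, Borel sets of matrices *)

Section RintegralFacts.
Context {d : measure_display} {W : measurableType d} {R : realType}.
Variable P : probability W R.

Lemma Rintegral_sum {I : Type} (s : seq I) (f : I -> W -> R) :
  (forall i, P.-integrable setT (EFin \o f i)) ->
  P.-integrable setT (EFin \o (fun w => \sum_(i <- s) f i w)) /\
  \int[P]_w (\sum_(i <- s) f i w) = \sum_(i <- s) \int[P]_w f i w.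
Proof.
move=> fi; elim: s => [|i s [IH1 IH2]].
  rewrite big_nil (_ : (fun w => \sum_(i <- [::]) _) = cst 0); last first.
    by apply/funext => w; rewrite big_nil.
  by split; [exact: finite_measure_integrable_cst|rewrite Rintegral_cst// mul0r].
rewrite (_ : (fun w => \sum_(j <- _) _) = fun w => f i w + \sum_(j <- s) f j w); last first.
  by apply/funext => w; rewrite big_cons.
split; first exact: integrable_addr.
by rewrite big_cons -IH2 RintegralD.
Qed.

Lemma eq_law_Rintegral (X Y : W -> R) : measurable_fun setT X -> measurable_fun setT Y ->
  (forall B, measurable B -> P (X @^-1` B) = P (Y @^-1` B)) ->
  P.-integrable setT (EFin \o X) -> P.-integrable setT (EFin \o Y) ->
  \int[P]_w X w = \int[P]_w Y w.
Proof.
move=> mX mY XY iX iY.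
pose X' : {RV P >-> R} := HB.pack X (@isMeasurableFun.Build _ _ _ _ X mX).
pose Y' : {RV P >-> R} := HB.pack Y (@isMeasurableFun.Build _ _ _ _ Y mY).
rewrite /Rintegral -[X in fine X](integral_distribution (X := X') _ iX)//.
rewrite -[X in _ = fine X](integral_distribution (X := Y') _ iY)//.
congr fine; apply: eq_measure_integral => B mB _; exact: XY.
Qed.

Lemma measurable_mulmx p q r (A : W -> 'M[R]_(p, q)) (B : W -> 'M[R]_(q, r)) :
  (forall i j, measurable_fun setT (fun w => A w i j)) ->
  (forall i j, measurable_fun setT (fun w => B w i j)) ->
  forall i j, measurable_fun setT (fun w => (A w *m B w) i j).
Proof.
move=> mA mB i j; under eq_fun do rewrite mxE.
by apply: measurable_sum => l; exact: measurable_funM.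
Qed.

Lemma measurable_random_mx p q (U : 'I_p -> 'I_q -> {RV P >-> R}) i j :
  measurable_fun setT (fun w => random_mx U w i j).
Proof. by under eq_fun do rewrite mxE; exact: measurable_funPT. Qed.

Lemma continuous_exp_entry n (s : R) (i j : 'I_n) :
  continuous (fun M : 'M[R]_n => expR (s * M i j)).
Proof.
move=> M; apply: (@continuous_comp _ _ _ (fun M : 'M[R]_n => s * M i j) expR).
  apply: (@continuousM _ 'M[R]_n (cst s) (fun M => M i j)); first exact: cst_continuous.
  exact: coord_continuous.
exact: continuous_expR.
Qed.

(** Lets the invariance in [uniform_row_space], stated for Borel sets of matrices, be applied to the
    law of a continuous real function of the projection. *)
Lemma open_sigma_preimage n (F : 'M[R]_n -> R) (B : set R) : continuous F ->
  measurable B -> <<s @open 'M[R]_n >> (F @^-1` B).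
Proof.
move=> cF mB; pose T := g_sigma_algebraType (@open 'M[R]_n).
suff mF : measurable_fun setT (F : T -> R).
  by have := mF measurableT _ mB; rewrite setTI.
apply: (measurability _ (RGenOInfty.measurableE R)) => _ [_ [x ->] <-].
rewrite setTI; apply: sub_sigma_algebra.
by move/continuousP: cF; apply; exact: rray_open.
Qed.

End RintegralFacts.

(** * Tail bounds for a uniformly random subspace *)

Section ProjectorTail.
Context {d : measure_display} {W : measurableType d} {R : realType}.
Variable P : probability W R.
Variables (k m : nat).
Local Notation n := m.+1.
Variable Q : 'I_k -> 'I_n -> {RV P >-> R}.
Hypothesis Q_orthonormal : forall w, random_mx Q w *m (random_mx Q w)^T = 1%:M.
Hypothesis Q_uniform : uniform_row_space Q.

Let Pi w := (random_mx Q w)^T *m random_mx Q w.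

Let tr_Pi w : (Pi w)^T = Pi w.
Proof. by rewrite /Pi trmx_mul trmxK. Qed.

Let Pi_idem w : Pi w *m Pi w = Pi w.
Proof. by rewrite /Pi mulmxA -(mulmxA _ _ (_^T)) Q_orthonormal mulmx1. Qed.

Let Pi_trace w : \sum_i Pi w i i = k%:R.
Proof.
by rewrite -[LHS]/(\tr (Pi w)) /Pi mxtrace_mulC Q_orthonormal mxtrace1.
Qed.

Let Pi_sym w i j : Pi w i j = Pi w j i.
Proof. by rewrite -{1}tr_Pi mxE. Qed.

Let Pi_diag w i : Pi w i i = \sum_j Pi w i j ^+ 2.
Proof.
rewrite -{1}Pi_idem mxE; apply: eq_bigr => j _.
by rewrite expr2 [in X in _ * X]Pi_sym.
Qed.

Let Pi_sqr_le w i j : Pi w i j ^+ 2 <= Pi w i i.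
Proof.
rewrite [leRHS]Pi_diag (bigD1 j)//= lerDl.
by apply: sumr_ge0 => l _; exact: sqr_ge0.
Qed.

Let Pi_diag01 w i : 0 <= Pi w i i <= 1.
Proof.
have h := Pi_sqr_le w i i; have h0 := sqr_ge0 (Pi w i i).
have p0 : 0 <= Pi w i i by lra.
rewrite p0 leNgt; apply/negP => p1; nra.
Qed.

Let Pi_le1 w i j : `|Pi w i j| <= 1.
Proof.
have /andP[_ h1] := Pi_diag01 w i; have := Pi_sqr_le w i j.
rewrite -(real_normK (num_real (Pi w i j))); have := normr_ge0 (Pi w i j); nra.
Qed.

Let Pi_measurable i j : measurable_fun setT (fun w => Pi w i j).
Proof.
apply: measurable_mulmx => i' j'; last exact: measurable_random_mx.
by under eq_fun do rewrite mxE; exact: measurable_random_mx.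
Qed.

Let law_conj (F : 'M[R]_n -> R) (O : 'M[R]_n) : continuous F -> O *m O^T = 1%:M ->
  measurable_fun setT (fun w => F (O *m Pi w *m O^T)) ->
  measurable_fun setT (fun w => F (Pi w)) ->
  P.-integrable setT (EFin \o (fun w => F (O *m Pi w *m O^T))) ->
  P.-integrable setT (EFin \o (fun w => F (Pi w))) ->
  \int[P]_w F (O *m Pi w *m O^T) = \int[P]_w F (Pi w).
Proof.
move=> cF OO m1 m2; apply: eq_law_Rintegral => // B mB.
exact: (Q_uniform OO (open_sigma_preimage cF mB)).
Qed.

Let expR_le_norm (s x : R) : `|x| <= 4 -> expR (s * x) <= expR (4 * `|s|).
Proof.
move=> x4; rewrite ler_expR (le_trans (ler_norm _))// normrM mulrC.
by rewrite ler_wpM2r.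
Qed.

(* Differentiating the invariance of the law along the rotations of the plane
   [(0,l)] at the identity. *)
Let stein (s : R) (l : 'I_n) : 0 != l ->
  \int[P]_w (expR (s * Pi w 0 0) *
    (2 * s * Pi w 0 l ^+ 2 + (Pi w l l - Pi w 0 0))) = 0.
Proof.
move=> l0.
pose x w := rot_diag (Pi w 0 0) (Pi w 0 l) (Pi w l l).
pose y w := rot_offdiag (Pi w 0 0) (Pi w 0 l) (Pi w l l).
pose y' w := rot_offdiag' (Pi w 0 0) (Pi w 0 l) (Pi w l l).
have bnd w t := rot_bounds t (Pi_le1 w 0 0) (Pi_le1 w 0 l) (Pi_le1 w l l).
pose f t w := expR (s * x w t) * y w t.
pose f' t w := expR (s * x w t) * (s * (2 * y w t)) * y w t + expR (s * x w t) * y' w t.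
have mx t : measurable_fun setT (fun w => x w t).
  rewrite /x /rot_diag; apply: measurable_funD; last exact: measurable_funM.
  by apply: measurable_funD; apply: measurable_funM => //; exact: measurable_funM.
have my t : measurable_fun setT (fun w => y w t).
  rewrite /y /rot_offdiag; apply: measurable_funD; first apply: measurable_funD.
  - exact: measurable_funM.
  - by apply: measurable_funM => //; exact: measurableT_comp.
  - by apply: measurable_funM => //; exact: measurable_funB.
have mf t : measurable_fun setT (f t).
  apply: measurable_funM => //; apply: measurableT_comp => //.
  exact: measurable_funM.
have fd (t : R) w : is_derive t 1 (f ^~ w) (f' t w).
  apply: is_derive_mul; last exact: is_derive_rot_offdiag.
  apply: is_derive_expR_comp.
  have dx := is_derive_rot_diag (Pi w 0 0) (Pi w 0 l) (Pi w l l) t.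
  by apply: is_derive_eq (is_derive_mul (is_derive_cst s t 1) dx) _; rewrite mul0r add0r.
have ex w t : expR (s * x w t) <= expR (4 * `|s|).
  by have [h _ _] := bnd w t; exact: expR_le_norm.
have fB t w : `|f t w| <= expR (4 * `|s|) * 4.
  have [_ h _] := bnd w t.
  by rewrite normrM ler_pM// ger0_norm// expR_ge0.
have f'B t w : `|f' t w| <= expR (4 * `|s|) * (`|s| * 8) * 4 + expR (4 * `|s|) * 8.
  have [_ h h'] := bnd w t.
  rewrite (le_trans (ler_normD _ _))// lerD// !normrM (ger0_norm (expR_ge0 _)).
    rewrite ler_pM ?mulr_ge0 ?expR_ge0// ler_pM ?mulr_ge0 ?expR_ge0//.
    by rewrite ler_wpM2l// ger0_norm//; move: h; rewrite -/(y w t); lra.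
  by rewrite ler_pM ?expR_ge0.
have := is_derive_Rintegral P (a := 0) fd mf (fun t w _ => fB t w) (fun t w _ => f'B t w).
pose F (M : 'M[R]_n) := expR (s * M 0 0) * M 0 l.
have cF : continuous F.
  move=> M; apply: (@continuousM _ 'M[R]_n (fun M => expR (s * M 0 0)) (fun M => M 0 l)).
    exact: continuous_exp_entry.
  exact: coord_continuous.
(* [f t] is minus [F] at the reflected projection, whose law does not depend on [t]; hence the
   integral is constant and its derivative at 0 vanishes. *)
have -> : (fun t => \int[P]_w f t w) = cst (- \int[P]_w F (Pi w)).
  apply/funext => t /=.
  have refl w := reflection_entries t l0 (tr_Pi w).
  set a := (cos (t / 2) *: _ + _) in refl.
  have a1 : dotv a a = 1 by case: (refl point).
  have FE w : F (householder a *m Pi w *m (householder a)^T) = - f t w.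
    by have [_ h1 h2] := refl w; rewrite /F h1 h2 mulrN.
  have iF : P.-integrable setT (EFin \o (fun w => F (Pi w))).
    apply: (@bounded_integrable _ _ _ _ _ (expR (4 * `|s|))).
      by apply: measurable_funM => //; apply: measurableT_comp => //; exact: measurable_funM.
    move=> w; rewrite normrM (ger0_norm (expR_ge0 _)) -[leRHS]mulr1 ler_pM ?expR_ge0//.
    by apply: expR_le_norm; apply: le_trans (Pi_le1 _ _ _) _; lra.
  have if_ : P.-integrable setT (EFin \o f t).
    exact: (bounded_integrable P (mf t) (fB t)).
  rewrite -(law_conj cF (householder_orthogonal a1))//.
  - under [in RHS]eq_Rintegral do rewrite FE -mulN1r.
    by rewrite RintegralZl// mulN1r opprK.
  - by under eq_fun do rewrite FE; exact: measurableT_comp.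
  - by apply: measurable_funM => //; apply: measurableT_comp => //; exact: measurable_funM.
  - rewrite (_ : (fun w => F _) = fun w => -1 * f t w); first exact: integrable_scaler.
    by apply/funext => w; rewrite FE mulN1r.
case=> _; rewrite derive_cst => E; rewrite [RHS]E.
apply: eq_Rintegral => w _; rewrite /f' /x /y /y' /rot_diag /rot_offdiag /rot_offdiag'.
by rewrite cos0 sin0 !(mul1r, mul0r, mulr0, addr0, subr0, oppr0, add0r); ring.
Qed.

Let psi (s : R) := \int[P]_w expR (s * Pi w 0 0).
Let psi' (s : R) := \int[P]_w (expR (s * Pi w 0 0) * Pi w 0 0).
(** By idempotence [Pi 0 0 - Pi 0 0 ^+ 2] is the sum of [Pi 0 l ^+ 2] over [l != 0], the quantity
    produced by summing [stein]. *)
Let rem (s : R) := \int[P]_w (expR (s * Pi w 0 0) * (Pi w 0 0 - Pi w 0 0 ^+ 2)).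

Let mexp s : measurable_fun setT (fun w => expR (s * Pi w 0 0)).
Proof. by apply: measurableT_comp => //; exact: measurable_funM. Qed.

Let int_exp_mul s (g : W -> R) (B : R) : measurable_fun setT g ->
  (forall w, `|g w| <= B) ->
  P.-integrable setT (EFin \o (fun w => expR (s * Pi w 0 0) * g w)).
Proof.
move=> mg gB; apply: (@bounded_integrable _ _ _ _ _ (expR (4 * `|s|) * B)).
  exact: measurable_funM.
move=> w; rewrite normrM (ger0_norm (expR_ge0 _)) ler_pM ?expR_ge0//.
by apply: expR_le_norm; apply: le_trans (Pi_le1 _ _ _) _; lra.
Qed.

Let int_exp s : P.-integrable setT (EFin \o (fun w => expR (s * Pi w 0 0))).
Proof.
apply: (@bounded_integrable _ _ _ _ _ (expR (4 * `|s|))) => // w.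
rewrite (ger0_norm (expR_ge0 _)); apply: expR_le_norm.
by apply: le_trans (Pi_le1 _ _ _) _; lra.
Qed.

Let m_rem : measurable_fun setT (fun w => Pi w 0 0 - Pi w 0 0 ^+ 2).
Proof. by apply: measurable_funB => //; exact: measurable_funX. Qed.

Let rem_bnd w : `|Pi w 0 0 - Pi w 0 0 ^+ 2| <= 1.
Proof. by have := Pi_diag01 w 0; rewrite ler_norml => /andP[]; nra. Qed.

Let is_derive_psi (s : R) : is_derive s 1 psi (psi' s).
Proof.
apply: (is_derive_Rintegral P (f := fun t w => expR (t * Pi w 0 0))
  (f' := fun t w => expR (t * Pi w 0 0) * Pi w 0 0) (B := expR (4 * (`|s| + 1))) (M := expR (4 * (`|s| + 1)))).
- move=> t w; apply: is_derive_expR_comp.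
  apply: is_derive_eq (is_derive_mulr _ (is_derive_id t 1)) _; by rewrite mul1r.
- exact: mexp.
- move=> t w ts; rewrite (ger0_norm (expR_ge0 _)).
  apply: le_trans (_ : expR (4 * `|t|) <= _).
    by apply: expR_le_norm; apply: le_trans (Pi_le1 _ _ _) _; lra.
  rewrite ler_expR; have := ler_normD s (t - s); rewrite subrKC; lra.
- move=> t w ts; rewrite normrM (ger0_norm (expR_ge0 _)) -[leRHS]mulr1 ler_pM ?expR_ge0//.
  apply: le_trans (_ : expR (4 * `|t|) <= _).
    by apply: expR_le_norm; apply: le_trans (Pi_le1 _ _ _) _; lra.
  rewrite ler_expR; have := ler_normD s (t - s); rewrite subrKC; lra.
Qed.

(** Summed over [l], the differences [Pi l l - Pi 0 0] give [k - n * Pi 0 0] by the trace, and the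
    squares give [Pi 0 0 - Pi 0 0 ^+ 2] by idempotence. *)
Let stein_sum (s : R) : n%:R * psi' s = k%:R * psi s + 2 * s * rem s.
Proof.
pose g (l : 'I_n) w := expR (s * Pi w 0 0) *
  (2 * s * Pi w 0 l ^+ 2 + (Pi w l l - Pi w 0 0)).
pose g' (l : 'I_n) w := if 0 == l then 0 else g l w.
have gi l : P.-integrable setT (EFin \o g' l).
  rewrite /g'; case: eqP => _; first exact: finite_measure_integrable_cst.
  apply: (@int_exp_mul _ _ (2 * `|s| + 2)).
    apply: measurable_funD; last exact: measurable_funB.
    by apply: measurable_funM => //; exact: measurable_funX.
  move=> w; rewrite (le_trans (ler_normD _ _))// lerD//.
    rewrite normrM (normrM 2) (ger0_norm (x := 2))// normrX -[leRHS]mulr1.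
    by rewrite ler_wpM2l ?mulr_ge0// expr_le1.
  by rewrite (le_trans (ler_normB _ _))// (le_trans (lerD (Pi_le1 _ _ _) (Pi_le1 _ _ _))).
have [_] := Rintegral_sum (index_enum 'I_n) gi.
rewrite [RHS]big1 => [|l _]; last first.
  rewrite /g'; have [_|l0] := eqVneq 0 l; last exact: stein.
  by rewrite Rintegral_cst// mul0r.
have -> : \int[P]_w (\sum_l g' l w) = \int[P]_w (2 * s *
    (expR (s * Pi w 0 0) * (Pi w 0 0 - Pi w 0 0 ^+ 2)) +
    (k%:R * expR (s * Pi w 0 0) - n%:R * (expR (s * Pi w 0 0) * Pi w 0 0))).
  apply: eq_Rintegral => w _.
  transitivity (\sum_l g l w - g 0 w).
    rewrite (bigD1 0)//= [in RHS](bigD1 0)//= /g' eqxx add0r [RHS]addrAC subrr add0r.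
    by apply: eq_bigr => l /negbTE; rewrite eq_sym => ->.
  rewrite /g -mulr_sumr !big_split/= -mulr_sumr -Pi_diag Pi_trace sumr_const card_ord.
  by rewrite -mulr_natl; ring.
have i1 := int_exp_mul s m_rem rem_bnd.
have i2 := int_exp s.
have i3 := int_exp_mul s (Pi_measurable 0 0) (fun w => Pi_le1 w 0 0).
have i4 := integrable_scaler (k%:R) i2.
have i5 := integrable_scaler (n%:R) i3.
rewrite RintegralD//; last 2 first.
- exact: integrable_scaler.
- by apply: eq_integrable (integrableB measurableT i4 i5).
rewrite RintegralB// !RintegralZl// -/(psi s) -/(psi' s) -/(rem s); lra.
Qed.

Let rem_le s : rem s <= psi' s.
Proof.
apply: le_Rintegral => //.
- exact: int_exp_mul m_rem rem_bnd.
- exact: (int_exp_mul s (Pi_measurable 0 0) (fun w => Pi_le1 w 0 0)).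
- by move=> w _; rewrite ler_wpM2l ?expR_ge0// gerBl sqr_ge0.
Qed.

Let psi_ge0 s : 0 <= psi s.
Proof. by apply: Rintegral_ge0 => w _; exact: expR_ge0. Qed.

Let psi0 : psi 0 = 1.
Proof.
rewrite /psi; under eq_Rintegral do rewrite mul0r expR0.
by rewrite Rintegral_cst//= probability_setT mulr1.
Qed.

Let n0 : 0 < n%:R :> R. Proof. by rewrite ltr0n. Qed.

(* [stein_sum] and [rem s <= psi' s] bound [psi' / psi] by the derivative of the
   exponent. *)
Lemma projector_mgf_upper (s : R) : 0 <= s <= n%:R / 4 ->
  psi s <= expR (k%:R / n%:R * s + 2 * (k%:R / n%:R ^+ 2) * s ^+ 2).
Proof.
move=> /andP[s0 s4].
pose b (t : R) := - (k%:R / n%:R * t + 2 * (k%:R / n%:R ^+ 2) * t ^+ 2).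
pose b' (t : R) := - (k%:R / n%:R + 4 * (k%:R / n%:R ^+ 2) * t).
have bd (t : R) : is_derive t 1 b (b' t).
  by apply: is_derive_eq; rewrite /GRing.scale/= /b'; ring.
have := @nonincreasing_of_derive R (fun t => psi t * expR (b t))
  (fun t => psi' t * expR (b t) + psi t * (expR (b t) * b' t)) s s0.
have b0 : b 0 = 0 by rewrite /b; ring.
rewrite psi0 b0 expR0 mulr1 => H.
suff : psi s * expR (b s) <= 1.
  by rewrite /b expRN ler_pdivrMr ?expR_gt0// mul1r.
apply: H => [t|t /andP[t0 ts]].
  exact: (is_derive_mul (is_derive_psi t) (is_derive_expR_comp (bd t))).
have -> : psi' t * expR (b t) + psi t * (expR (b t) * b' t) =
  expR (b t) * (psi' t + psi t * b' t) by ring.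
rewrite pmulr_rle0 ?expR_gt0// /b' mulrN subr_le0.
have st := stein_sum t; have rl := rem_le t; have p0 := psi_ge0 t.
have h1 : (n%:R - 2 * t) * psi' t <= k%:R * psi t by nra.
have kp : 0 <= k%:R * psi t by rewrite mulr_ge0.
have h2 : 0 < n%:R - 2 * t by have := n0; lra.
rewrite -(ler_pM2l h2); apply: le_trans h1 _.
have -> : (n%:R - 2 * t) * (psi t * (k%:R / n%:R + 4 * (k%:R / n%:R ^+ 2) * t)) =
  k%:R * psi t * ((n%:R - 2 * t) * (n%:R + 4 * t) / n%:R ^+ 2).
  by field; rewrite gt_eqF.
(* [(n - 2 t) (n + 4 t) = n ^+ 2 + 2 t (n - 4 t)], which is where the restriction to [s <= n / 4]
   comes from. *)
rewrite ler_peMr// ler_pdivlMr ?exprn_gt0// mul1r; nra.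
Qed.

(** At [- t] the remainder has the opposite sign and [(n + 2 t) psi' >= k psi]. Since
    [(n + 2 t) (n - 2 t) <= n ^+ 2] always holds, [s] has no upper limit here. *)
Lemma projector_mgf_lower (s : R) : 0 <= s ->
  psi (- s) <= expR (- (k%:R / n%:R * s) + k%:R / n%:R ^+ 2 * s ^+ 2).
Proof.
move=> s0.
pose b (t : R) := k%:R / n%:R * t - k%:R / n%:R ^+ 2 * t ^+ 2.
pose b' (t : R) := k%:R / n%:R - 2 * (k%:R / n%:R ^+ 2) * t.
have bd (t : R) : is_derive t 1 b (b' t).
  by apply: is_derive_eq; rewrite /GRing.scale/= /b'; ring.
have := @nonincreasing_of_derive R (fun t => psi (- t) * expR (b t))
  (fun t => psi' (- t) * (-1) * expR (b t) + psi (- t) * (expR (b t) * b' t)) s s0.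
have b0 : b 0 = 0 by rewrite /b; ring.
rewrite oppr0 psi0 b0 expR0 mulr1 => H.
suff : psi (- s) * expR (b s) <= 1.
  rewrite -[b s]opprK expRN ler_pdivrMr ?expR_gt0// mul1r.
  by rewrite /b opprB addrC.
apply: H => [t|t /andP[t0 ts]].
  have dN : is_derive t 1 (fun x => psi (- x)) (psi' (- t) * (-1)).
    exact: (@is_derive1_comp R psi -%R t _ _ (is_derive_psi (- t)) (is_deriveNid t 1)).
  exact: (is_derive_mul dN (is_derive_expR_comp (bd t))).
have -> : psi' (- t) * (-1) * expR (b t) + psi (- t) * (expR (b t) * b' t) =
  expR (b t) * (psi (- t) * b' t - psi' (- t)) by ring.
rewrite pmulr_rle0 ?expR_gt0// subr_le0 /b'.
have st := stein_sum (- t); have rl := rem_le (- t); have p0 := psi_ge0 (- t).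
have h1 : k%:R * psi (- t) <= (n%:R + 2 * t) * psi' (- t) by nra.
have kp : 0 <= k%:R * psi (- t) by rewrite mulr_ge0.
have h2 : 0 < n%:R + 2 * t by have := n0; lra.
rewrite -(ler_pM2l h2); apply: le_trans h1.
have -> : (n%:R + 2 * t) * (psi (- t) * (k%:R / n%:R - 2 * (k%:R / n%:R ^+ 2) * t)) =
  k%:R * psi (- t) * ((n%:R + 2 * t) * (n%:R - 2 * t) / n%:R ^+ 2).
  by field; rewrite gt_eqF.
rewrite ler_piMr// ler_pdivrMr ?exprn_gt0// mul1r; have := sqr_ge0 t; nra.
Qed.

Let sqr_proj (u : 'cV[R]_n) w := dotv (random_mx Q w *m u) (random_mx Q w *m u).

Let sqr_projE u w : sqr_proj u w = dotv u (Pi w *m u).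
Proof. by rewrite /sqr_proj dotv_mulmxl mulmxA. Qed.

Let sqr_proj_measurable u : measurable_fun setT (sqr_proj u).
Proof.
have mQu i : measurable_fun setT (fun w => (random_mx Q w *m u) i 0).
  by apply: measurable_mulmx => // i' j'; exact: measurable_random_mx.
rewrite (_ : sqr_proj u = fun w => \sum_i (random_mx Q w *m u) i 0 ^+ 2).
  by apply: measurable_sum => i; exact: measurable_funX.
by apply/funext => w; rewrite /sqr_proj dotvE; apply: eq_bigr => i _; rewrite expr2.
Qed.

(** The reflection along [u - e_0] exchanges [u] and the basis vector [e_0], so [sqr_proj u] has the
    law of the entry [Pi 0 0]. The case [u = e_0], where that direction vanishes, is immediate. *)
Lemma projector_mgf (u : 'cV[R]_n) (s : R) : dotv u u = 1 ->
  (\int[P]_w (expR (s * sqr_proj u w))%:E = (psi s)%:E)%E.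
Proof.
move=> u1.
have Epsi : (psi s)%:E = (\int[P]_w (expR (s * Pi w 0 0))%:E)%E.
  by rewrite fineK//; exact: integral_fune_fin_num (int_exp s).
have [ue|ue] := eqVneq u (delta_mx 0 0).
  by rewrite Epsi; apply: eq_integral => w _; rewrite sqr_projE ue dotv_delta.
pose v := u - delta_mx 0 0; pose a := (Num.sqrt (dotv v v))^-1 *: v.
have v0 : 0 < dotv v v by rewrite lt0r dotvv_ge0 dotvv_eq0 subr_eq0 ue.
have a1 : dotv a a = 1.
  rewrite /a dotvZl dotvZr mulrA -invfM -expr2 sqr_sqrtr ?mulVf ?gt_eqF//.
  exact: ltW.
have ee : dotv (delta_mx 0 0) (delta_mx 0 0 : 'cV[R]_n) = 1.
  by rewrite dotv_delta2 eqxx.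
have vv : dotv v v = 2 - 2 * dotv u (delta_mx 0 0).
  rewrite /v dotvBl !dotvBr u1 (dotvC (delta_mx 0 0) u) ee; ring.
have Hu : (householder a)^T *m delta_mx 0 0 = u.
  rewrite tr_householder householderE /a dotvZl scalerA mulrAC -!mulrA.
  rewrite (mulrA _^-1) -invfM -expr2 sqr_sqrtr ?(ltW v0)//.
  have -> : 2 * ((dotv v v)^-1 * dotv v (delta_mx 0 0)) = -1.
    have : dotv v (delta_mx 0 0) = - (dotv v v / 2).
      by rewrite vv {1}/v dotvBl ee; field.
    by move=> ->; field; rewrite gt_eqF.
  by rewrite scaleN1r opprK /v subrKC.
have E w : sqr_proj u w = (householder a *m Pi w *m (householder a)^T) 0 0.
  by rewrite conj_entry Hu sqr_projE.
(* [sqr_proj u] lies between 0 and 1, the upper bound being the nonnegativity of the squared norm of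
   [u - Pi u]. *)
have i1 : P.-integrable setT (EFin \o (fun w => expR (s * sqr_proj u w))).
  apply: (@bounded_integrable _ _ _ _ _ (expR `|s|)).
    by apply: measurableT_comp => //; exact: measurable_funM.
  move=> w; rewrite (ger0_norm (expR_ge0 _)) ler_expR (le_trans (ler_norm _))//.
  rewrite normrM ler_piMr//.
  have p0 : 0 <= sqr_proj u w by exact: dotvv_ge0.
  have p1 : 0 <= dotv (u - Pi w *m u) (u - Pi w *m u) by exact: dotvv_ge0.
  rewrite ger0_norm//; move: p1; rewrite !dotvBl !dotvBr u1.
  rewrite [dotv (Pi w *m u) (Pi w *m u)]dotv_mulmxl tr_Pi mulmxA Pi_idem.
  rewrite [dotv (Pi w *m u) u]dotvC -sqr_projE; lra.
rewrite Epsi -(fineK (integral_fune_fin_num measurableT i1)).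
rewrite -(fineK (integral_fune_fin_num measurableT (int_exp s))); congr EFin.
rewrite -[LHS]/(\int[P]_w (expR (s * sqr_proj u w))) -[RHS]/(psi s).
pose F (M : 'M[R]_n) := expR (s * M 0 0).
have cF : continuous F by exact: continuous_exp_entry.
have FE : (fun w => F (householder a *m Pi w *m (householder a)^T)) =
    fun w => expR (s * sqr_proj u w) by apply/funext => w; rewrite E.
have := law_conj cF (householder_orthogonal a1); rewrite FE => -> //.
- by apply: measurableT_comp => //; exact: measurable_funM.
- exact: mexp.
- exact: int_exp.
Qed.

Lemma projector_tail_upper (u : 'cV[R]_n) (eps : R) : dotv u u = 1 -> 0 < eps <= 1 ->
  (P [set w | (k%:R / n%:R * (1 + eps) <= sqr_proj u w)%R] <=
   (expR (- (eps ^+ 2 * k%:R / 8)))%:E)%E.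
Proof.
move=> u1 /andP[e0 e1].
(* The minimizer of the Chernoff exponent; [eps <= 1] keeps it in the range of
   [projector_mgf_upper]. *)
pose s : R := n%:R * eps / 4.
have s0 : 0 < s by rewrite !mulr_gt0.
have -> : [set w | (k%:R / n%:R * (1 + eps) <= sqr_proj u w)%R] =
  [set w | (s * (k%:R / n%:R * (1 + eps)) <= s * sqr_proj u w)%R].
  by apply/seteqP; split=> w /=; rewrite ler_pM2l.
have sb : 0 <= s <= n%:R / 4.
  by rewrite (ltW s0)/= ler_pM2r ?invr_gt0// ler_piMr// ltW.
have ms : measurable_fun setT (fun w => s * sqr_proj u w) by exact: measurable_funM.
apply: le_trans (chernoff_bound (f := fun w => s * sqr_proj u w)
  (a := k%:R / n%:R * s + 2 * (k%:R / n%:R ^+ 2) * s ^+ 2) _ ms _) _.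
  by rewrite projector_mgf// lee_fin; exact: projector_mgf_upper.
rewrite lee_fin ler_expR le_eqVlt; apply/orP; left; apply/eqP.
by rewrite /s; field; rewrite gt_eqF.
Qed.

Lemma projector_tail_lower (u : 'cV[R]_n) (eps : R) : dotv u u = 1 -> 0 < eps <= 1 ->
  (P [set w | (sqr_proj u w <= k%:R / n%:R * (1 - eps))%R] <=
   (expR (- (eps ^+ 2 * k%:R / 8)))%:E)%E.
Proof.
move=> u1 /andP[e0 e1].
(* Again the minimizer. It gives the better rate [1 / 4], weakened below to [1 / 8] to match the
   upper tail. *)
pose s : R := n%:R * eps / 2.
have s0 : 0 < s by rewrite !mulr_gt0.
have -> : [set w | (sqr_proj u w <= k%:R / n%:R * (1 - eps))%R] =
  [set w | (- s * (k%:R / n%:R * (1 - eps)) <= - s * sqr_proj u w)%R].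
  by apply/seteqP; split=> w /=; rewrite ler_nM2l// oppr_lt0.
have ms : measurable_fun setT (fun w => - s * sqr_proj u w) by exact: measurable_funM.
apply: le_trans (chernoff_bound (f := fun w => - s * sqr_proj u w)
  (a := - (k%:R / n%:R * s) + k%:R / n%:R ^+ 2 * s ^+ 2) _ ms _) _.
  by rewrite projector_mgf// lee_fin; apply: projector_mgf_lower; exact: ltW.
rewrite lee_fin ler_expR.
have -> : - (k%:R / n%:R * s) + k%:R / n%:R ^+ 2 * s ^+ 2 -
    - s * (k%:R / n%:R * (1 - eps)) = - (eps ^+ 2 * k%:R / 4).
  by rewrite /s; field; rewrite gt_eqF.
rewrite lerN2 ler_wpM2l//; first by rewrite mulr_ge0// sqr_ge0.
by rewrite lef_pV2 ?posrE//; lra.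
Qed.

End ProjectorTail.

(** * Uniform tail bounds for all four projectors, and scalar products *)

Section RandomProjectorTail.
Context {d : measure_display} {W : measurableType d} {R : realType}.
Variable P : probability W R.

Lemma random_projector_measurable k m (T : W -> 'M[R]_(k, m)) i j :
  random_projector P T -> measurable_fun setT (fun w => T w i j).
Proof.
have sc (a : R) (U : 'I_k -> 'I_m -> {RV P >-> R}) : (forall w, T w = a *: random_mx U w) ->
    measurable_fun setT (fun w => T w i j).
  move=> TE; under eq_fun do rewrite TE mxE.
  by apply: measurable_funM => //; exact: measurable_random_mx.
by case=> U _; [move=> _ _|move=> _|move=> _|move=> _]; exact: sc.
Qed.

Lemma dotv_scale_random_mx k m (U : 'I_k -> 'I_m -> {RV P >-> R}) (a b : R) v w :
  b ^+ 2 * k%:R = a ^+ 2 -> (0 < k)%N ->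
  dotv ((b *: random_mx U w) *m v) ((b *: random_mx U w) *m v) =
  k%:R^-1 * \sum_i (\sum_j v j 0 * (a * U i j w)) ^+ 2.
Proof.
move=> ab k0; have k0' : k%:R != 0 :> R by rewrite pnatr_eq0 -lt0n.
rewrite -scalemxAl dotvZl dotvZr mulrA -expr2 dotvE !mulr_sumr.
apply: eq_bigr => i _; rewrite -expr2.
have -> : \sum_j v j 0 * (a * U i j w) = a * (random_mx U w *m v) i 0.
  by rewrite mxE mulr_sumr; apply: eq_bigr => j _; rewrite !mxE; ring.
by rewrite exprMn -ab; field.
Qed.

(** The factor [a] normalizes an entry to unit variance while [b] is the scale in [T]; they are 1
    and [1 / sqrt k], or [sqrt 3] and [sqrt (3 / k)] for sparse signs. *)
Lemma iid_projector_tail k m (T : W -> 'M[R]_(k, m))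
    (U : 'I_k -> 'I_m -> {RV P >-> R}) (a b eps : R) (v : 'cV[R]_m) :
  independent_entries U -> (forall i j, subgaussian P 1 (fun w => a * U i j w)) ->
  (forall w, T w = b *: random_mx U w) -> b ^+ 2 * k%:R = a ^+ 2 -> (0 < k)%N ->
  dotv v v = 1 -> 0 < eps <= 1 ->
  (P [set w | (1 + eps <= dotv (T w *m v) (T w *m v))%R] <=
     (expR (- (eps ^+ 2 * k%:R / (4 * chi_const R))))%:E)%E /\
  (P [set w | (dotv (T w *m v) (T w *m v) <= 1 - eps)%R] <=
     (expR (- (eps ^+ 2 * k%:R / (4 * chi_const R))))%:E)%E.
Proof.
move=> indU sU TE ab k0 v1 eps01.
have k0' : 0 < k%:R :> R by rewrite ltr0n.
have v1' : \sum_j v j 0 ^+ 2 = 1.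
  by rewrite -v1 dotvE; apply: eq_bigr => j _; rewrite expr2.
have tail sg := row_tail (X := fun ij : 'I_k * 'I_m => U ij.1 ij.2) indU
  (a := a) (fun ij => sU ij.1 ij.2) v1' (sg := sg) (eps := eps).
have sumE (sg : R) w : \sum_(i < k) sg * ((\sum_j v j 0 * (a * U i j w)) ^+ 2 - 1) =
    sg * (k%:R * dotv (T w *m v) (T w *m v) - k%:R).
  rewrite TE (dotv_scale_random_mx _ _ _ ab k0) mulrA divff ?gt_eqF// mul1r.
  by rewrite -mulr_sumr sumrB sumr_const card_ord.
split.
- rewrite (_ : [set w | _] = [set w | (k%:R * eps <=
      \sum_(i < k) 1 * ((\sum_j v j 0 * (a * U i j w)) ^+ 2 - 1))%R]).
    by apply: tail; rewrite ?normr1.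
  apply/seteqP; split=> w /=; rewrite sumE mul1r -[X in _ - X]mulr1 -mulrBr ler_pM2l//; lra.
- rewrite (_ : [set w | _] = [set w | (k%:R * eps <=
      \sum_(i < k) (-1) * ((\sum_j v j 0 * (a * U i j w)) ^+ 2 - 1))%R]).
    by apply: tail; rewrite ?normrN1.
  apply/seteqP; split=> w /=;
    rewrite sumE mulN1r -[X in - (_ - X)]mulr1 -mulrBr -mulrN ler_pM2l//; lra.
Qed.

Lemma random_projector_unit_tail k m (T : W -> 'M[R]_(k, m)) (v : 'cV[R]_m) (eps : R) :
  random_projector P T -> (0 < k)%N -> dotv v v = 1 -> 0 < eps <= 1 ->
  (P [set w | (1 + eps <= dotv (T w *m v) (T w *m v))%R] <=
     (expR (- (eps ^+ 2 * k%:R / (4 * chi_const R))))%:E)%E /\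
  (P [set w | (dotv (T w *m v) (T w *m v) <= 1 - eps)%R] <=
     (expR (- (eps ^+ 2 * k%:R / (4 * chi_const R))))%:E)%E.
Proof.
move=> TP k0 v1 eps01; have k0' : 0 < k%:R :> R by rewrite ltr0n.
have sk : (Num.sqrt k%:R)^-1 ^+ 2 * k%:R = 1 ^+ 2 :> R.
  by rewrite exprVn sqr_sqrtr ?ler0n// mulVf ?gt_eqF// expr1n.
case: TP => [Q km QQ Qu TE|U iU nU TE|U iU rU TE|U iU sU TE].
(* A unit vector excludes dimension 0; the subspace argument uses the index 0 and so is written for
   [m.+1]. *)
- case: m => [|m] in T v v1 Q km QQ Qu TE *.
    by move: v1; rewrite dotvE big_ord0 => /esym/eqP; rewrite oner_eq0.
  have m0 : 0 < m.+1%:R :> R by rewrite ltr0n.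
  have C48 := @chi_const_ge48 R.
  have le8 : expR (- (eps ^+ 2 * k%:R / 8)) <= expR (- (eps ^+ 2 * k%:R / (4 * chi_const R))).
    rewrite ler_expR lerN2 ler_wpM2l 1?mulr_ge0 ?sqr_ge0//.
    by rewrite lef_pV2 ?posrE//; lra.
  have dE w : dotv (T w *m v) (T w *m v) =
      m.+1%:R / k%:R * dotv (random_mx Q w *m v) (random_mx Q w *m v).
    by rewrite TE -scalemxAl dotvZl dotvZr mulrA -expr2 sqr_sqrtr.
  have mk0 : 0 < m.+1%:R / k%:R :> R by rewrite divr_gt0.
  have mkV (x : R) : m.+1%:R / k%:R * (k%:R / m.+1%:R * x) = x.
    by field; rewrite !gt_eqF.
  split.
  + rewrite (_ : [set w | _] = [set w | (k%:R / m.+1%:R * (1 + eps) <=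
        dotv (random_mx Q w *m v) (random_mx Q w *m v))%R]).
      by apply: le_trans (projector_tail_upper QQ Qu v1 eps01) _; rewrite lee_fin.
    by apply/seteqP; split=> w /=; rewrite dE -(ler_pM2l mk0 (k%:R / _ * _)) mkV.
  + rewrite (_ : [set w | _] = [set w | (dotv (random_mx Q w *m v) (random_mx Q w *m v) <=
        k%:R / m.+1%:R * (1 - eps))%R]).
      by apply: le_trans (projector_tail_lower QQ Qu v1 eps01) _; rewrite lee_fin.
    by apply/seteqP; split=> w /=; rewrite dE -(ler_pM2l mk0 _ (k%:R / _ * _)) mkV.
- apply: (iid_projector_tail (a := 1) iU _ TE) => //.
  by move=> i j; exact: standard_normal_subgaussian.
- apply: (iid_projector_tail (a := 1) iU _ TE) => //.
  by move=> i j; exact: rademacher_subgaussian.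
- apply: (iid_projector_tail (a := Num.sqrt 3) iU _ TE) => //.
    by move=> i j; exact: sparse_sign_subgaussian.
  by rewrite sqr_sqrtr ?divr_ge0 ?ler0n// sqr_sqrtr ?ler0n// divfK// gt_eqF.
Qed.

Section InnerProduct.
Variables (k m : nat) (T : W -> 'M[R]_(k, m)).
Hypothesis TP : random_projector P T.
Hypothesis k0 : (0 < k)%N.

Lemma projected_dotv_measurable (u v : 'cV[R]_m) :
  measurable_fun setT (fun w => dotv (T w *m u) (T w *m v)).
Proof.
have mT (x : 'cV[R]_m) i : measurable_fun setT (fun w => (T w *m x) i 0).
  apply: measurable_mulmx => [i' j'|i' j']; last exact: measurable_cst.
  exact: random_projector_measurable.
under eq_fun do rewrite dotvE.
by apply: measurable_sum => i; exact: measurable_funM.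
Qed.

Lemma measurable_lt (f g : W -> R) : measurable_fun setT f -> measurable_fun setT g ->
  measurable [set w | f w < g w].
Proof.
move=> mf mg; have := measurable_fun_ltr mf mg => mfg.
by have := mfg measurableT [set true] I; rewrite setTI.
Qed.

(** Normalization reduces to unit vectors. The inequalities are strict so that both events are empty
    when [v = 0], a case that occurs for [y - a] and [y + a]. *)
Lemma random_projector_tail (v : 'cV[R]_m) (eps : R) : 0 < eps <= 1 ->
  (P [set w | ((1 + eps) * dotv v v < dotv (T w *m v) (T w *m v))%R] <=
     (expR (- (eps ^+ 2 * k%:R / (4 * chi_const R))))%:E)%E /\
  (P [set w | (dotv (T w *m v) (T w *m v) < (1 - eps) * dotv v v)%R] <=
     (expR (- (eps ^+ 2 * k%:R / (4 * chi_const R))))%:E)%E.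
Proof.
move=> eps01; have [->|v0] := eqVneq v 0.
  have d00 p : dotv (0 : 'cV[R]_p) 0 = 0 by rewrite /dotv mulmx0 mxE.
  have e : [set w : W | (0 < 0 :> R)%R] = set0.
    by apply/seteqP; split=> // w /=; rewrite ltxx.
  split; rewrite (_ : [set w | _] = set0) ?measure0 ?lee_fin ?expR_ge0//;
    by apply/seteqP; split=> // w /=; rewrite mulmx0 !d00 mulr0 ltxx.
have vv0 : 0 < dotv v v by rewrite lt0r dotvv_ge0 dotvv_eq0 v0.
pose c := (Num.sqrt (dotv v v))^-1.
have c2 : c ^+ 2 = (dotv v v)^-1 by rewrite exprVn sqr_sqrtr// ltW.
have u1 : dotv (c *: v) (c *: v) = 1.
  by rewrite dotvZl dotvZr mulrA -expr2 c2 mulVf ?gt_eqF.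
have [up lo] := random_projector_unit_tail TP k0 u1 eps01.
have dE w : dotv (T w *m (c *: v)) (T w *m (c *: v)) =
    (dotv v v)^-1 * dotv (T w *m v) (T w *m v).
  by rewrite -scalemxAr dotvZl dotvZr mulrA -expr2 c2.
have md := projected_dotv_measurable v v.
split; [apply: le_trans up|apply: le_trans lo]; apply: le_measure; rewrite ?inE.
- by apply: measurable_lt.
- rewrite (_ : [set w | _] = ~` [set w | dotv (T w *m (c *: v)) (T w *m (c *: v)) < 1 + eps]).
    by apply: measurableC; apply: measurable_lt => //; exact: projected_dotv_measurable.
  by apply/seteqP; split=> w /=; [rewrite leNgt => /negP|move=> /negP; rewrite -leNgt].
- by move=> w /=; rewrite dE ler_pdivlMl// mulrC => /ltW.
- by apply: measurable_lt.
- rewrite (_ : [set w | _] = ~` [set w | 1 - eps < dotv (T w *m (c *: v)) (T w *m (c *: v))]).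
    by apply: measurableC; apply: measurable_lt => //; exact: projected_dotv_measurable.
  by apply/seteqP; split=> w /=; [rewrite leNgt => /negP|move=> /negP; rewrite -leNgt].
- by move=> w /=; rewrite dE ler_pdivrMl// mulrC => /ltW.
Qed.

(* Polarization. *)
Lemma projected_dotv_tail (y a : 'cV[R]_m) (eps : R) : 0 < eps <= 1 ->
  dotv y y = 1 -> dotv a a = 1 ->
  (P [set w | (dotv y a + eps < dotv (T w *m y) (T w *m a))%R] <=
     (2 * expR (- (eps ^+ 2 * k%:R / (4 * chi_const R))))%:E)%E.
Proof.
move=> eps01 y1 a1.
have [up _] := random_projector_tail (y + a) eps01.
have [_ lo] := random_projector_tail (y - a) eps01.
set A := [set w | _] in up; set B := [set w | _] in lo.
have mA : measurable A by apply: measurable_lt => //; exact: projected_dotv_measurable.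
have mB : measurable B by apply: measurable_lt => //; exact: projected_dotv_measurable.
apply: (@le_trans _ _ (P (A `|` B))).
  apply: le_measure; rewrite ?inE.
  - by apply: measurable_lt => //; exact: projected_dotv_measurable.
  - exact: measurableU.
  move=> w /= h.
  have [hA|hA] := ltP ((1 + eps) * dotv (y + a) (y + a))
    (dotv (T w *m (y + a)) (T w *m (y + a))); [by left|right; rewrite /B /=].
  (* Outside both events, [4 <T y, T a>] is at most [4 <y, a> + eps (|y + a| ^+ 2 + |y - a| ^+ 2)],
     and the last sum of squares is 4 for unit vectors. *)
  rewrite ltNge; apply/negP => hB.
  move: h hA hB; rewrite !mulmxBr !mulmxDr !(dotvBl, dotvBr, dotvDl, dotvDr) y1 a1.
  rewrite (dotvC a y) (dotvC (T w *m a) (T w *m y)); lra.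
apply: le_trans (measureU2 _ mA mB) _.
by rewrite mulr_natl mulr2n EFinD; exact: leeD.
Qed.

End InnerProduct.
End RandomProjectorTail.

(** * Values of the programs and measurability of the projected value *)

Section ProjectedProgram.
Variable R : realType.

Lemma min_value_minimizer n (c : 'cV[R]_n) (F : set 'cV[R]_n) x :
  minimizer c F x -> min_value c F = (dotv c x)%:E.
Proof.
move=> [Fx xmin]; apply/eqP; rewrite eq_le; apply/andP; split.
  by apply: ereal_inf_lbound; exists x.
by apply: le_ereal_inf_tmp => _ [z Fz <-]; rewrite lee_fin; exact: xmin.
Qed.

Lemma min_value_ge n (c : 'cV[R]_n) (F : set 'cV[R]_n) r :
  (r%:E <= min_value c F)%E <-> forall x, F x -> r <= dotv c x.
Proof.
split=> [h x Fx|h]; last first.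
  by apply: le_ereal_inf_tmp => _ [z Fz <-]; rewrite lee_fin; exact: h.
by rewrite -lee_fin; apply: le_trans h _; apply: ereal_inf_lbound; exists x.
Qed.

Lemma weak_duality m n (A : 'M[R]_(m, n)) (b : 'cV[R]_m) (c : 'cV[R]_n) x y :
  feasible A b x -> dual_feasible A c y -> dotv b y <= dotv c x.
Proof.
move=> [Ax x0] Ay; rewrite -Ax dotv_mulmxl dotvC !dotvE.
by apply: ler_sum => j _; rewrite ler_wpM2r.
Qed.

(** Both optima are attained by assumption, so letting [e] tend to 0 in [lp_duality] gives
    equality. *)
Lemma strong_duality m n (A : 'M[R]_(m, n)) (b : 'cV[R]_m) (c : 'cV[R]_n) x y :
  minimizer c (feasible A b) x -> maximizer b (dual_feasible A c) y ->
  dotv b y = dotv c x.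
Proof.
move=> [Fx xmin] [Dy ymax]; apply/eqP; rewrite eq_le (weak_duality Fx Dy)/=.
apply/ler_addgt0Pr => e e0; rewrite -lerBlDr.
have [z Dz bz] := lp_duality (ex_intro _ x Fx) xmin e0.
exact: le_trans (ltW bz) (ymax z Dz).
Qed.

Lemma cauchy_schwarz m (u v : 'cV[R]_m) : enorm u = 1 -> `|dotv u v| <= enorm v.
Proof.
move=> u1; have uu : dotv u u = 1 by rewrite -sqr_enorm u1 expr1n.
have : 0 <= dotv (v - dotv u v *: u) (v - dotv u v *: u) by exact: dotvv_ge0.
rewrite !dotvBl !dotvBr !dotvZl !dotvZr uu (dotvC v u) => h.
rewrite -ler_sqr ?nnegrE ?enorm_ge0// sqr_enorm real_normK ?num_real//.
rewrite expr2; lra.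
Qed.

Section Measurability.
Context {d : measure_display} {W : measurableType d}.

(* Strict feasibility lets the real dual vectors of the projected program be
   replaced by rational ones, so the event becomes a countable union. *)
Lemma projected_value_dual k n (N : 'M[R]_(k, n)) (p : 'cV[R]_k) (c : 'cV[R]_n)
    (theta r : R) : 0 < theta ->
  (exists2 x, feasible N p x & \sum_j x j 0 <= theta) ->
  (forall x, feasible N p x -> \sum_j x j 0 <= theta -> r <= dotv c x) <->
  (forall e : nat, exists z : 'cV[rat]_k * rat,
     [/\ forall j, \sum_i N i j * ratr (z.1 i 0) + ratr z.2 < c j 0,
         ratr z.2 < 0 :> R &
         r - e.+1%:R^-1 < \sum_i p i 0 * ratr (z.1 i 0) + theta * ratr z.2]).
Proof.
move=> theta0 [x0 Fx0 x0theta]; split=> [rP e|H x [Nx x_ge0] xtheta]; last first.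
  apply/ler_addgt0Pr => e e0.
  have [[q t] [/= qc t0 qr]] := H (Num.trunc e^-1).
  have e1 : (Num.trunc e^-1).+1%:R^-1 <= e.
    rewrite -[leRHS]invrK lef_pV2 ?posrE ?invr_gt0//.
    have /andP[_ /ltW//] : ((Num.trunc e^-1)%:R <= e^-1 < (Num.trunc e^-1).+1%:R)%R.
    by apply: truncn_itv; rewrite invr_ge0 ltW.
  rewrite -lerBlDr; apply: le_trans (_ : r - (Num.trunc e^-1).+1%:R^-1 <= _).
    by rewrite lerB.
  apply: le_trans (ltW qr) _.
  apply: le_trans (_ : \sum_j (\sum_i N i j * ratr (q i 0) + ratr t) * x j 0 <= _).
    under [leRHS]eq_bigr do rewrite mulrDl mulr_suml.
    rewrite big_split/= exchange_big/= -mulr_sumr lerD//.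
      rewrite le_eqVlt; apply/orP; left; apply/eqP; apply: eq_bigr => i _.
      rewrite -Nx mxE mulr_suml; apply: eq_bigr => j _; ring.
    by rewrite mulrC ler_wnM2l// ltW.
  by rewrite dotvE; apply: ler_sum => j _; rewrite ler_wpM2r// ltW.
(* A slack coordinate turns the bound on the sum of [x] into an equation, so that [lp_duality]
   applies; its dual variable is [t]. *)
pose M := block_mx N (0 : 'M[R]_(k, 1)) (const_mx 1 : 'rV[R]_n) (1%:M : 'M[R]_1).
pose p' := col_mx p (theta%:M : 'M[R]_1).
pose c' := col_mx c (0 : 'cV[R]_1).
have Mcol x s : M *m col_mx x s = col_mx (N *m x) ((\sum_j x j 0)%:M + s).
  rewrite mul_block_col mul0mx addr0 mul1mx; congr (col_mx _ (_ + _)).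
  apply/matrixP => i j; rewrite !ord1 !mxE eqxx mulr1n.
  by apply: eq_bigr => l _; rewrite mxE mul1r.
have Fne : feasible M p' !=set0.
  exists (col_mx x0 (theta - \sum_j x0 j 0)%:M); have [Nx0 x0_ge0] := Fx0; split.
    by rewrite Mcol Nx0 -raddfD/= subrKC.
  move=> j; case: (split_ordP j) => i ->; first by rewrite col_mxEu.
  by rewrite col_mxEd !ord1 mxE eqxx mulr1n subr_ge0.
have Fr x : feasible M p' x -> r <= dotv c' x.
  rewrite -(vsubmxK x); set x1 := usubmx x; set s := dsubmx x => -[].
  rewrite Mcol => /eq_col_mx[Nx1 /matrixP/(_ 0 0)]; rewrite !mxE eqxx mulr1n => xs x_ge0.
  rewrite dotv_col_mx [X in _ + X]/dotv trmx0 mul0mx mxE addr0; apply: rP.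
    by split=> // j; have := x_ge0 (lshift 1 j); rewrite col_mxEu.
  by have := x_ge0 (rshift n 0); rewrite col_mxEd mxE; move: xs => /=; lra.
pose eta : R := (2 * e.+1%:R)^-1.
have eta0 : 0 < eta by rewrite invr_gt0 mulr_gt0// ltr0n.
have [z] := lp_duality Fne Fr eta0.
rewrite -(vsubmxK z); set y := usubmx z; set s := dsubmx z.
rewrite [s]mx11_scalar; set t := s 0 0 => zdual.
have -> : dotv p' (col_mx y t%:M) = dotv p y + theta * t.
  by rewrite dotv_col_mx [X in _ + X]dotvE big_ord1 !mxE eqxx !mulr1n.
move=> zval.
have yc j : \sum_i N i j * y i 0 + t <= c j 0.
  have := zdual (lshift 1 j); rewrite tr_block_mx mul_block_col col_mxEu mul_mx_scalar.
  rewrite /c' col_mxEu !mxE mulr1; apply: le_trans; rewrite lerD2r.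
  by rewrite le_eqVlt; apply/orP; left; apply/eqP; apply: eq_bigr => i _; rewrite [_^T _ _]mxE.
have t0 : t <= 0.
  have := zdual (rshift n 0); rewrite tr_block_mx mul_block_col col_mxEd.
  by rewrite trmx0 mul0mx add0r trmx1 mul1mx col_mxEd !mxE eqxx mulr1n.
pose L := 1 + \sum_i (`|p i 0| + \sum_j `|N i j|).
have L1 : 1 <= L by rewrite lerDl sumr_ge0// => i _; rewrite addr_ge0// sumr_ge0.
have L0 : 0 < L by lra.
(* Rounding [y] costs at most [kap / 2] in every constraint and in the objective. Lowering [t] by
   between [kap] and [2 kap] makes the constraints strict at a cost of at most [2 theta kap], so the
   rounding loses less than [eta] in total; [lp_duality] has used the other [eta]. *)
pose kap := eta / (1 + 2 * theta).
have kap0 : 0 < kap by rewrite divr_gt0//; lra.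
have kapE : kap * (1 + 2 * theta) = eta by rewrite divfK// gt_eqF//; lra.
pose sig := kap / (2 * L).
have sig0 : 0 < sig by rewrite divr_gt0// mulr_gt0.
have sigE : L * sig = kap / 2 by rewrite /sig; field; rewrite gt_eqF.
have /choice[q qy] : forall i, exists q : rat, `|ratr q - y i 0| < sig.
  move=> i; have [|q] := @rat_in_itvoo R (y i 0 - sig) (y i 0 + sig); first by lra.
  by rewrite in_itv/= => /andP[h1 h2]; exists q; rewrite ltr_norml; apply/andP; split; lra.
have [|tau] := @rat_in_itvoo R (t - 2 * kap) (t - kap); first by lra.
rewrite in_itv/= => /andP[tau1 tau2].
have approx (a : 'I_k -> R) : \sum_i `|a i| <= L ->
    `|\sum_i a i * ratr (q i) - \sum_i a i * y i 0| <= kap / 2.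
  move=> aL; rewrite -sumrB -sigE; apply: le_trans (ler_norm_sum _ _ _) _.
  apply: le_trans (_ : (\sum_i `|a i|) * sig <= _); last by rewrite ler_wpM2r// ltW.
  rewrite mulr_suml; apply: ler_sum => i _.
  by rewrite -mulrBr normrM ler_wpM2l// ltW.
exists (\col_i q i, tau) => /=; split.
- move=> j; have := approx (fun i => N i j).
  have -> : \sum_i N i j * ratr ((\col_i q i) i 0) = \sum_i N i j * ratr (q i).
    by apply: eq_bigr => i _; rewrite mxE.
  have NL : \sum_i `|N i j| <= L.
    rewrite /L -[leLHS]add0r lerD//; apply: ler_sum => i _.
    by rewrite -[leLHS]add0r lerD// (bigD1 j)//= lerDl sumr_ge0.
  move=> /(_ NL); rewrite ler_norml => /andP[_]; have := yc j; lra.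
- lra.
- have := approx (fun i => p i 0).
  have -> : \sum_i p i 0 * ratr ((\col_i q i) i 0) = \sum_i p i 0 * ratr (q i).
    by apply: eq_bigr => i _; rewrite mxE.
  have pL : \sum_i `|p i 0| <= L.
    rewrite /L -[leLHS]add0r lerD//; apply: ler_sum => i _.
    by rewrite lerDl sumr_ge0.
  move=> /(_ pL); rewrite ler_norml => /andP[h _].
  move: zval; rewrite dotvE => zval.
  have e2 : e.+1%:R^-1 = eta + eta :> R.
    by rewrite /eta invfM -mulrDl (_ : 2^-1 + 2^-1 = 1 :> R) ?mul1r//; lra.
  have h3 : theta * (t - 2 * kap) <= theta * ratr tau by rewrite ler_wpM2l// ltW.
  rewrite e2; lra.
Qed.

Lemma projected_value_measurable k n (N : W -> 'M[R]_(k, n)) (p : W -> 'cV[R]_k)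
    (c : 'cV[R]_n) (theta r : R) : 0 < theta ->
  (forall i j, measurable_fun setT (fun w => N w i j)) ->
  (forall i, measurable_fun setT (fun w => p w i 0)) ->
  (forall w, exists2 x, feasible (N w) (p w) x & \sum_j x j 0 <= theta) ->
  measurable [set w | forall x, feasible (N w) (p w) x ->
    \sum_j x j 0 <= theta -> r <= dotv c x].
Proof.
move=> theta0 mN mp ne.
pose E (e : nat) (z : 'cV[rat]_k * rat) :=
  (\bigcap_(j in [set: 'I_n])
     [set w | \sum_i N w i j * ratr (z.1 i 0) + ratr z.2 < c j 0]) `&`
  ([set w | ratr z.2 < 0 :> R] `&`
   [set w | r - e.+1%:R^-1 < \sum_i p w i 0 * ratr (z.1 i 0) + theta * ratr z.2]).
rewrite (_ : [set w | _] = \bigcap_e \bigcup_z E e z).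
  apply: bigcapT_measurable => e; apply: countable_bigcupT_measurable => [|z].
    exact: countableP.
  apply: measurableI; last apply: measurableI.
  - apply: fin_bigcap_measurable => // j _; apply: measurable_lt => //.
    apply: measurable_funD => //.
    by apply: measurable_sum => i; exact: measurable_funM.
  - exact: measurable_lt.
  - apply: measurable_lt => //; apply: measurable_funD => //.
    by apply: measurable_sum => i; exact: measurable_funM.
apply/seteqP; split=> w /=.
  move=> /(projected_value_dual c r theta0 (ne w)) H e _.
  by have [z [h1 h2 h3]] := H e; exists z => //; split=> [j _|]; [exact: h1|split].
move=> H; apply/(projected_value_dual c r theta0 (ne w)) => e.
by have [z _ [h1 [h2 h3]]] := H e I; exists z; split=> // j; exact: h1.
Qed.

End Measurability.

End ProjectedProgram.

(** * Union bound and final estimate *)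

Lemma measure_bigcup_le {d : measure_display} {W : measurableType d} {R : realType}
    (P : probability W R) n (F : 'I_n -> set W) (a : R) :
  (forall j, measurable (F j)) -> (forall j, (P (F j) <= a%:E)%E) ->
  (P (\bigcup_j F j) <= (n%:R * a)%:E)%E.
Proof.
move=> mF Fa; apply: le_trans (_ : (\sum_(j \in [set: 'I_n]) P (F j) <= _)%E).
  apply: (content_sub_fsum P) => //; first exact: finite_finset.
  by apply: fin_bigcup_measurable => //; exact: finite_finset.
rewrite (_ : [set: 'I_n] = [set` enum 'I_n]); last first.
  by apply/seteqP; split=> j //= _; rewrite mem_enum.
rewrite -fsbig_seq ?enum_uniq// big_enum/=.
apply: le_trans (_ : (\sum_(j < n) a%:E <= _)%E); first by apply: lee_sum => j _.
by rewrite sumEFin sumr_const card_ord mulr_natl.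
Qed.

Theorem theorem4p3 (R : realType) :
  exists C c0 : R, 0 < C /\ 0 < c0 /\
  forall (m n k : nat) (A : 'M[R]_(m, n)) (b : 'cV[R]_m) (c : 'cV[R]_n)
    (theta delta : R) (ystar : 'cV[R]_m)
    (d : measure_display) (W : measurableType d) (P : probability W R)
    (T : W -> 'M[R]_(k, m)),
  let vP := min_value c (feasible A b) in
  let vPT w := min_value c (projected_feasible A b (T w) theta) in
  let eps := c0 * (delta / (theta ^+ 2 * enorm ystar)) in
  enorm b = 1 -> enorm c = 1 -> (forall j, enorm (col j A) = 1) ->
  bounded_set (feasible A b) -> feasible A b !=set0 ->
  1 <= theta ->
  (exists xstar, minimizer c (feasible A b) xstar /\
     \sum_j xstar j 0 < theta) ->
  min_norm_dual_optimum A b c ystar ->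
  0 < delta -> (delta%:E <= `|vP|)%E ->
  random_projector P T ->
  ((1 - 4 * n%:R * expR (- (C * (eps ^+ 2 - eps ^+ 3) * k%:R)))%:E <=
   P [set w | (vP - delta%:E <= vPT w)%E /\ (vPT w <= vP)%E])%E.
Proof.
have C48 := @chi_const_ge48 R.
exists (4 * chi_const R)^-1, (2^-1); split; first by rewrite invr_gt0; lra.
split; first by lra.
move=> m n k A b c theta delta ystar d W P T vP vPT eps b1 _ A1 _ _ theta1.
move=> [xstar [xmin xtheta]] [ymax _] delta0 deltav TP.
have theta0 : 0 < theta by lra.
have vPE : vP = (dotv c xstar)%:E by exact: min_value_minimizer.
have byE := strong_duality xmin ymax.
have [Fx _] := xmin; have [Dy _] := ymax.
have xproj w : projected_feasible A b (T w) theta xstar.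
  by have [Ax x0] := Fx; split; [split=> //; rewrite -mulmxA Ax|exact: ltW].
set L := enorm ystar in eps *.
have deltaL : delta <= L.
  move: deltav; rewrite vPE abse_EFin lee_fin -byE => /le_trans; apply.
  exact: cauchy_schwarz.
have L0 : 0 < L by lra.
(* Without columns [b] would be 0. The bound [1 <= n] is what gives [2 (n + 1) <= 4 n] at the
   end. *)
have n0 : (0 < n)%N.
  case: n => // in A c vP vPT A1 xstar xmin xtheta ymax deltav vPE byE Fx Dy xproj *.
  have [Ax _] := Fx; move: b1; rewrite -Ax (thinmx0 A) mul0mx => /eqP.
  by rewrite /enorm /dotv mulmx0 mxE sqrtr0 eq_sym oner_eq0.
have [k0|k0] := posnP k.
  apply: le_trans (measure_ge0 _ _); rewrite lee_fin k0 mulr0 oppr0 expR0 mulr1.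
  have : 1 <= n%:R :> R by rewrite ler1n.
  lra.
pose e0 := delta / (2 * theta * L).
have e0E : e0 * (2 * theta * L) = delta by rewrite divfK// gt_eqF// !mulr_gt0.
have e00 : 0 < e0 by rewrite divr_gt0// !mulr_gt0.
have e01 : e0 <= 1.
  rewrite ler_pdivrMr ?mulr_gt0// mul1r; apply: le_trans deltaL _.
  by rewrite ler_peMl ?ltW//; lra.
have eps_e0 : eps ^+ 2 - eps ^+ 3 <= e0 ^+ 2.
  have epsE : eps = e0 / theta by rewrite /eps /e0; field; rewrite !gt_eqF.
  have eps0 : 0 <= eps by rewrite epsE divr_ge0 ?ltW.
  rewrite lerBlDr -[leLHS]addr0 lerD ?exprn_ge0// ler_sqr ?nnegrE//; last exact: ltW.
  by rewrite epsE ler_pdivrMr// ler_peMr// ltW.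
pose tail := 2 * expR (- (e0 ^+ 2 * k%:R / (4 * chi_const R))).
have enorm1 (v : 'cV[R]_m) : enorm v = 1 -> dotv v v = 1.
  by move=> v1; rewrite -sqr_enorm v1 expr1n.
pose y := L^-1 *: ystar.
have y1 : dotv y y = 1.
  by rewrite dotvZl dotvZr -sqr_enorm -/L; field; rewrite gt_eqF.
have Nb1 : dotv (- b) (- b) = 1 by rewrite dotvNl dotvNr opprK enorm1.
pose bad a := [set w | dotv y a + e0 < dotv (T w *m y) (T w *m a)].
have mbad a : measurable (bad a).
  by apply: measurable_lt; [exact: measurable_cst|exact: (projected_dotv_measurable TP)].
have bad_le a : dotv a a = 1 -> (P (bad a) <= tail%:E)%E.
  by move=> a1; apply: projected_dotv_tail; rewrite ?e00.
(* The columns need an upper bound on the projected product and [b] a lower one; passing to [- b]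
   makes both one-sided events of the same form. *)
pose Bad := bad (- b) `|` \bigcup_j bad (col j A).
have mBad : measurable Bad.
  by apply: measurableU => //; apply: fin_bigcup_measurable.
have PBad : (P Bad <= (n.+1%:R * tail)%:E)%E.
  apply: le_trans (measureU2 _ _ _) _ => //; first exact: fin_bigcup_measurable.
  rewrite -[n.+1%:R]natr1 mulrDl mul1r EFinD addeC leeD ?bad_le//.
  by apply: measure_bigcup_le => // j; apply: bad_le; exact: enorm1.
set good := [set w | _].
(* The upper inequality holds surely by [xproj], so only the lower one remains in the event. *)
have goodE : good = [set w | forall x, feasible (T w *m A) (T w *m b) x ->
    \sum_j x j 0 <= theta -> dotv c xstar - delta <= dotv c x].
  apply/seteqP; split=> w /=.
    by rewrite /good/= vPE -EFinB => -[/min_value_ge h _] x Fx' xt; apply: h.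
  rewrite /good/= vPE -EFinB => h; split; first by apply/min_value_ge => x [Fx' xt]; exact: h.
  by apply: ereal_inf_lbound; exists xstar.
have mT i j := random_projector_measurable i j TP.
have mgood : measurable good.
  rewrite goodE; apply: projected_value_measurable => //.
  - by move=> i j; apply: measurable_mulmx => // i' j'; exact: measurable_cst.
  - by move=> i; apply: measurable_mulmx => // i' j'; exact: measurable_cst.
  - by move=> w; have [h1 h2] := xproj w; exists xstar.
have subgood : ~` Bad `<=` good.
  rewrite goodE => w /= /not_orP[badb badA] x [TAx x0] xt.
  have yb : dotv y b - e0 <= dotv (T w *m y) (T w *m b).
    have : dotv (T w *m y) (T w *m (- b)) <= dotv y (- b) + e0.
      by rewrite leNgt; apply/negP.
    by rewrite mulmxN !dotvNr; lra.
  have yA j : dotv (T w *m y) (T w *m col j A) <= dotv y (col j A) + e0.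
    by rewrite leNgt; apply/negP => h; apply: badA; exists j.
  have sumcol p (u : 'cV[R]_p) (B : 'M[R]_(p, n)) :
      dotv u (B *m x) = \sum_j dotv u (col j B) * x j 0.
    rewrite !dotvE; under eq_bigr do rewrite mxE mulr_sumr.
    rewrite exchange_big; apply: eq_bigr => j _; rewrite dotvE mulr_suml.
    by apply: eq_bigr => i _; rewrite mxE mulrA.
  have yAx : dotv (T w *m y) (T w *m b) <= dotv y (A *m x) + e0 * theta.
    rewrite -TAx !sumcol.
    apply: le_trans (_ : \sum_j (dotv y (col j A) + e0) * x j 0 <= _).
      by apply: ler_sum => j _; rewrite ler_wpM2r// colE -mulmxA -colE; exact: yA.
    under eq_bigr do rewrite mulrDl.
    by rewrite big_split/= -mulr_sumr lerD2l ler_wpM2l// ltW.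
  have cx : dotv ystar (A *m x) <= dotv c x.
    by rewrite dotvC; exact: (weak_duality (conj erefl x0) Dy).
  have yL v : dotv ystar v = L * dotv y v by rewrite dotvZl mulVKf ?gt_eqF.
  rewrite -byE dotvC yL; apply: le_trans cx; rewrite yL -e0E.
  have : L * (dotv y b - dotv y (A *m x)) <= L * (e0 * (2 * theta)).
    (* The error is [e0] from [b] and [e0 * theta] from the columns, weighted by [x] of total mass
       at most [theta]; [1 <= theta] merges them into [2 * theta * e0]. *)
    rewrite ler_pM2l//.
    have : e0 * (1 + theta) <= e0 * (2 * theta) by rewrite ler_pM2l//; lra.
    lra.
  lra.
apply: le_trans (_ : P (~` Bad) <= _)%E; last first.
  by apply: le_measure => //; rewrite inE//; exact: measurableC.
rewrite probability_setC// EFinB leeB//; apply: le_trans PBad _.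
rewrite lee_fin /tail mulrA; apply: ler_pM; rewrite ?expR_ge0 ?mulr_ge0//.
  have : 1 <= n%:R :> R by rewrite ler1n.
  rewrite -natr1; lra.
rewrite ler_expR lerN2 [X in X <= _]mulrAC mulrC [_^-1 * _]mulrC -[leRHS]mulrA.
by rewrite ler_wpM2r// divr_ge0//; lra.
Qed.
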